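(* Let $\mathbb{F}$ be a field of characteristic different from $2$ and let $(W,\{\cdot,\cdot,\cdot\})$ be a finite-dimensional simple associative triple system of the second kind over $\mathbb{F}$. Then the morphism $$\theta\colon \mathbf{Aut}(W,\{\cdot,\cdot,\cdot\})\to \mathbf{Aut}(\mathcal{A}(W),\varphi,\Gamma(W))$$ given by $\theta_R(\psi)=\mathcal{A}(\psi)$, for every commutative associative unital $\mathbb{F}$-algebra $R$ and every $\psi\in\mathbf{Aut}(W,\{\cdot,\cdot,\cdot\})(R)$, is an isomorphism of affine group schemes, with inverse given by restriction to the component of degree $-1$: $\theta_R^{-1}(\psi)=\psi|_{(\mathcal{A}(W)_R)_{-1}}$, where $(\mathcal{A}(W)_R)_{-1}=W_R$.
   Context: An associative triple system of the second kind (AT2) is a vector space $W$ with a trilinear product satisfying $\{\{u,v,x\},y,z\}=\{u,\{y,x,v\},z\}=\{u,v,\{x,y,z\}\}$. An ideal is a subspace $I$ with $\{I,W,W\}+\{W,I,W\}+\{W,W,I\}\subseteq I$; $W$ is simple if $\{W,W,W\}\neq 0$ and $W$ has no nonzero proper ideals. Construction of $\mathcal{A}(W)$ (Loos). Let $E=\mathrm{End}_{\mathbb{F}}(W)$ and define $l(x,y),r(x,y)\in E$ by $l(x,y)z=\{x,y,z\}=r(z,y)x$. On $E\oplus E^{op}$ and $E^{op}\oplus E$ let $\overline{(f,g)}=(g,f)$. Put $\lambda(x,y)=(l(x,y),l(y,x))\in E\oplus E^{op}$ and $\rho(x,y)=(r(y,x),r(x,y))\in E^{op}\oplus E$. Let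 $L_0$ (resp. $R_0$) be the span of all $\lambda(x,y)$ (resp. $\rho(x,y)$), $e_1$ (resp. $e_2$) the unit of $E\oplus E^{op}$ (resp. $E^{op}\oplus E$), and $L=\mathbb{F}e_1+L_0$, $\mathcal{R}=\mathbb{F}e_2+R_0$ (subalgebras stable under the bar). For $a=(a_1,a_2)\in L$, $b=(b_1,b_2)\in \mathcal{R}$, $x\in W$: $ax=a_1(x)$, $xa=a_2(x)$, $xb=b_1(x)$, $bx=b_2(x)$. Let $\overline{W}$ be a copy of $W$ (with the same formulas). Then $\mathcal{A}(W)=L\oplus W\oplus\overline{W}\oplus \mathcal{R}$, with elements written as $\begin{pmatrix} a & x \\ y & b \end{pmatrix}$ ($a\in L,x\in W,y\in\overline{W},b\in \mathcal{R}$), is a unital associative algebra with product $$\begin{pmatrix} a & x \\ y & b \end{pmatrix}\begin{pmatrix} a' & x' \\ y' & b' \end{pmatrix}=\begin{pmatrix} aa'+\lambda(x,y') & ax'+xb' \\ ya'+by' & \rho(y,x')+bb' \end{pmatrix}$$ and involution $\varphi\begin{pmatrix} a & x \\ y & b \end{pmatrix}=\begin{pmatrix} \overline{a} & y \\ x & \overline{b} \end{pmatrix}$. One has $\{w_1,w_2,w_3\}=w_1\varphi(w_2)w_3$ for $w_i\in W$. $\Gamma(W)$ is the $3$-grading $\mathcal{A}(W)=\mathcal{A}(W)_{-1}\oplus\mathcal{A}(W)_0\oplus\mathcal{A}(W)_1$ with $\mathcal{A}(W)_{-1}=W$, $\mathcal{A}(W)_0=L\oplus \mathcal{R}$, $\mathcal{A}(W)_1=\overline{W}$.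 When $W$ is simple, $\mathcal{A}(W)_0=\mathcal{A}(W)_1\mathcal{A}(W)_{-1}\oplus\mathcal{A}(W)_{-1}\mathcal{A}(W)_1$. For a commutative associative unital $\mathbb{F}$-algebra $R$, the subscript $R$ denotes extension of scalars $-\otimes_{\mathbb{F}}R$. $\mathbf{Aut}(W,\{\cdot,\cdot,\cdot\})(R)$ is the group of $R$-linear automorphisms of the triple system $W_R$; $\mathbf{Aut}(\mathcal{A}(W),\varphi,\Gamma(W))(R)$ is the group of $R$-algebra automorphisms of $\mathcal{A}(W)_R$ commuting with $\varphi_R$ and preserving each component of the $3$-grading. For $W$ simple and $\psi\in\mathbf{Aut}(W,\{\cdot,\cdot,\cdot\})(R)$, $\mathcal{A}(\psi)\colon\mathcal{A}(W)_R\to\mathcal{A}(W)_R$ is the $R$-linear map given by $\mathcal{A}(\psi)(a)=\psi(a)$ for $a$ of degree $-1$; $\mathcal{A}(\psi)(a)=\varphi(\psi(\varphi(a)))$ for $a$ of degree $1$; and $\mathcal{A}(\psi)(\sum_i a_ib_i)=\sum_i\mathcal{A}(\psi)(a_i)\mathcal{A}(\psi)(b_i)$ when all $a_i$ have degree $1$ and all $b_i$ degree $-1$, or all $a_i$ have degree $-1$ and all $b_i$ degree $1$. *)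

(* Defs.v *)
From HB Require Import structures.
From mathcomp Require Import all_boot all_order all_algebra.
From mathcomp Require Import boolp.

Set Implicit Arguments.
Unset Strict Implicit.
Unset Printing Implicit Defensive.
Import GRing.Theory.
Local Open Scope ring_scope.

Record at2 (F : fieldType) (W : vectType F) := AT2 {
  triple :> W -> W -> W -> W;
  triple_lin1 : forall y z, linear (fun x => triple x y z);
  triple_lin2 : forall x z, linear (fun y => triple x y z);
  triple_lin3 : forall x y, linear (fun z => triple x y z);
  triple_as12 : forall u v x y z,
    triple (triple u v x) y z = triple u (triple y x v) z;
  triple_as23 : forall u v x y z,
    triple u (triple y x v) z = triple u v (triple x y z) }.

Definition at2_ideal (F : fieldType) (W : vectType F) (T : at2 W)
    (I : {vspace W}) : Prop :=
  forall x y z, [|| x \in I, y \in I | z \in I] -> T x y z \in I.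

Definition at2_simple (F : fieldType) (W : vectType F) (T : at2 W) : Prop :=
  (exists x y z, T x y z != 0) /\
  (forall I : {vspace W}, at2_ideal T I -> I = 0%VS \/ I = fullv).

Lemma linear_zero (F : pzRingType) (U V : lmodType F) (f : U -> V) : linear f -> f 0 = 0.
Proof. by move=> fl; have := fl (-1) 0 0; rewrite !scaleN1r !addNr. Qed.

Section SpanInd.
Variables (F : fieldType) (V : vectType F) (P : V -> Prop).
Hypotheses (P0 : P 0) (Plin : forall a u v, P u -> P v -> P (a *: u + v)).

Lemma span_ind (X : seq V) :
  {in X, forall v, P v} -> {in <<X>>%VS, forall v, P v}.
Proof.
move=> PX v /(coord_span (X := in_tuple X)) ->.
apply: (big_ind P) => // [u w Pu Pw | i _].
  by rewrite -[u]scale1r; apply: Plin.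
by rewrite -[_ *: _]addr0; apply: Plin => //; apply/PX/mem_nth.
Qed.

Lemma addv_ind (U1 U2 : {vspace V}) :
    {in U1, forall v, P v} -> {in U2, forall v, P v} ->
  {in (U1 + U2)%VS, forall v, P v}.
Proof.
move=> P1 P2 v /memv_addP[u1 u1P [u2 u2P ->]].
by rewrite -[u1]scale1r; apply: Plin; [apply: P1 | apply: P2].
Qed.

Lemma line_ind (u : V) : P u -> {in <[u]>%VS, forall v, P v}.
Proof. by move=> Pu v /vlineP[k ->]; rewrite -[_ *: _]addr0; apply: Plin. Qed.

End SpanInd.

Section Loos.
Variables (F : fieldType) (W : vectType F) (T : at2 W).

Let EE : vectType F := ('End(W) * 'End(W))%type.

Definition triple_l (x y z : W) := T x y z.
Definition triple_r (x y z : W) := T z y x.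
HB.instance Definition _ x y :=
  GRing.isLinear.Build F W W *:%R (triple_l x y) (triple_lin3 T x y).
HB.instance Definition _ x y :=
  GRing.isLinear.Build F W W *:%R (triple_r x y) (triple_lin1 T y x).

Definition lop x y : 'End(W) := linfun (triple_l x y).
Definition rop x y : 'End(W) := linfun (triple_r x y).

Lemma lopE x y z : lop x y z = T x y z. Proof. by rewrite lfunE. Qed.
Lemma ropE x y z : rop x y z = T z y x. Proof. by rewrite lfunE. Qed.

Definition lambda x y : EE := (lop x y, lop y x).
Definition rho x y : EE := (rop y x, rop x y).

(* E (+) E^op and E^op (+) E have the same carrier, with the products mulEop and
   mulopE respectively. *)
Definition mulEop (a b : EE) : EE := ((a.1 \o b.1)%VF, (b.2 \o a.2)%VF).
Definition mulopE (a b : EE) : EE := ((b.1 \o a.1)%VF, (a.2 \o b.2)%VF).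
Definition unitE : EE := (\1%VF, \1%VF).
Definition barE (a : EE) : EE := (a.2, a.1).

(* By bilinearity the values on a basis span all lambda x y (resp. rho x y):
   see lambda_span and rho_span. *)
Definition L0 : {vspace EE} :=
  <<[seq lambda x y | x <- vbasis {:W}, y <- vbasis {:W}]>>%VS.
Definition R0 : {vspace EE} :=
  <<[seq rho x y | x <- vbasis {:W}, y <- vbasis {:W}]>>%VS.
Definition Lsp : {vspace EE} := (<[unitE]> + L0)%VS.
Definition Rsp : {vspace EE} := (<[unitE]> + R0)%VS.

Lemma lambda_linl y : linear (lambda ^~ y).
Proof.
move=> a u v; congr (_, _); apply/lfunP => z.
  by rewrite add_lfunE scale_lfunE !lopE triple_lin1.
by rewrite add_lfunE scale_lfunE !lopE triple_lin2.
Qed.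

Lemma lambda_linr x : linear (lambda x).
Proof.
move=> a u v; congr (_, _); apply/lfunP => z.
  by rewrite add_lfunE scale_lfunE !lopE triple_lin2.
by rewrite add_lfunE scale_lfunE !lopE triple_lin1.
Qed.

Lemma rho_linl y : linear (rho ^~ y).
Proof.
move=> a u v; congr (_, _); apply/lfunP => z.
  by rewrite add_lfunE scale_lfunE !ropE triple_lin2.
by rewrite add_lfunE scale_lfunE !ropE triple_lin3.
Qed.

Lemma rho_linr x : linear (rho x).
Proof.
move=> a u v; congr (_, _); apply/lfunP => z.
  by rewrite add_lfunE scale_lfunE !ropE triple_lin3.
by rewrite add_lfunE scale_lfunE !ropE triple_lin2.
Qed.

Lemma bilin_span (f : W -> W -> EE) :
    (forall y, linear (f ^~ y)) -> (forall x, linear (f x)) ->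
  forall x y, f x y \in <<[seq f x y | x <- vbasis {:W}, y <- vbasis {:W}]>>%VS.
Proof.
move=> fl fr x y; set S := <<_>>%VS.
have f0l v : f 0 v = 0 := linear_zero (fl v).
have f0r v : f v 0 = 0 := linear_zero (fr v).
have basW v : v \in <<vbasis {:W}>>%VS by rewrite (span_basis (vbasisP _)) memvf.
apply: (span_ind (P := fun u => f u y \in S) _ _ _ (basW x)) => [|a u v fu fv|u uB].
- by rewrite f0l mem0v.
- by rewrite fl memvD // memvZ.
apply: (span_ind (P := fun v => f u v \in S) _ _ _ (basW y)) => [|a v w fv fw|v vB].
- by rewrite f0r mem0v.
- by rewrite fr memvD // memvZ.
by apply/memv_span/allpairsP; exists (u, v).
Qed.

Lemma lambda_act x y z :
  (lambda x y).1 z = T x y z /\ (lambda x y).2 z = T y x z.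
Proof. by rewrite !lopE. Qed.

Lemma rho_act x y z :
  (rho x y).1 z = T z x y /\ (rho x y).2 z = T z y x.
Proof. by rewrite !ropE. Qed.

Lemma lambda_span x y : lambda x y \in L0.
Proof. exact: (bilin_span lambda_linl lambda_linr). Qed.

Lemma rho_span x y : rho x y \in R0.
Proof. exact: (bilin_span rho_linl rho_linr). Qed.

Lemma lambda_in x y : lambda x y \in Lsp.
Proof. exact: (subvP (addvSr _ _)) (lambda_span x y). Qed.

Lemma rho_in x y : rho x y \in Rsp.
Proof. exact: (subvP (addvSr _ _)) (rho_span x y). Qed.

Lemma unitL_in : unitE \in Lsp.
Proof. exact: (subvP (addvSl _ _)) (memv_line _). Qed.

Lemma unitR_in : unitE \in Rsp.
Proof. exact: (subvP (addvSl _ _)) (memv_line _). Qed.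

Lemma Lsp_ind (P : EE -> Prop) :
    P 0 -> (forall a u v, P u -> P v -> P (a *: u + v)) ->
    P unitE -> (forall x y, P (lambda x y)) ->
  {in Lsp, forall u, P u}.
Proof.
move=> P0 Pl P1 PL; apply: addv_ind => //; first exact: line_ind.
by apply: span_ind => // u /allpairsP[[x y] [_ _ ->]].
Qed.

Lemma Rsp_ind (P : EE -> Prop) :
    P 0 -> (forall a u v, P u -> P v -> P (a *: u + v)) ->
    P unitE -> (forall x y, P (rho x y)) ->
  {in Rsp, forall u, P u}.
Proof.
move=> P0 Pl P1 PL; apply: addv_ind => //; first exact: line_ind.
by apply: span_ind => // u /allpairsP[[x y] [_ _ ->]].
Qed.

Lemma mulEop_linl b : linear (mulEop ^~ b).
Proof.
by move=> a u v; rewrite /mulEop /= comp_lfunDl -comp_lfunZl comp_lfunDr -comp_lfunZr.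
Qed.
Lemma mulEop_linr b : linear (mulEop b).
Proof.
by move=> a u v; rewrite /mulEop /= comp_lfunDl -comp_lfunZl comp_lfunDr -comp_lfunZr.
Qed.
Lemma mulopE_linl b : linear (mulopE ^~ b).
Proof.
by move=> a u v; rewrite /mulopE /= comp_lfunDl -comp_lfunZl comp_lfunDr -comp_lfunZr.
Qed.
Lemma mulopE_linr b : linear (mulopE b).
Proof.
by move=> a u v; rewrite /mulopE /= comp_lfunDl -comp_lfunZl comp_lfunDr -comp_lfunZr.
Qed.

Lemma mul_unitE a :
  [/\ mulEop unitE a = a, mulEop a unitE = a,
      mulopE unitE a = a & mulopE a unitE = a].
Proof.
by case: a => a1 a2; rewrite /mulEop /mulopE /= !comp_lfun1l !comp_lfun1r.
Qed.

Lemma mul_lambda x y u v :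
  mulEop (lambda x y) (lambda u v) = lambda (T x y u) v.
Proof.
congr (_, _); apply/lfunP => z; rewrite comp_lfunE !lopE.
  by rewrite -triple_as23 -triple_as12.
by rewrite triple_as23.
Qed.

Lemma mul_rho x y u v : mulopE (rho x y) (rho u v) = rho x (T y u v).
Proof.
congr (_, _); apply/lfunP => z; rewrite comp_lfunE !ropE.
  by rewrite triple_as12 triple_as23 -triple_as23 -triple_as12 triple_as12 triple_as23.
by rewrite triple_as12.
Qed.

Lemma mulL_in a b : a \in Lsp -> b \in Lsp -> mulEop a b \in Lsp.
Proof.
move=> aL bL; move: a aL; apply: Lsp_ind => [|k u v uL vL||x y].
- by rewrite (linear_zero (mulEop_linl b)) mem0v.
- by rewrite mulEop_linl memvD // memvZ.
- by case: (mul_unitE b) => ->.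
move: b bL; apply: Lsp_ind => [|k u v uL vL||u v].
- by rewrite (linear_zero (mulEop_linr _)) mem0v.
- by rewrite mulEop_linr memvD // memvZ.
- by case: (mul_unitE (lambda x y)) => _ -> _ _; apply: lambda_in.
by rewrite mul_lambda lambda_in.
Qed.

Lemma mulR_in a b : a \in Rsp -> b \in Rsp -> mulopE a b \in Rsp.
Proof.
move=> aL bL; move: a aL; apply: Rsp_ind => [|k u v uL vL||x y].
- by rewrite (linear_zero (mulopE_linl b)) mem0v.
- by rewrite mulopE_linl memvD // memvZ.
- by case: (mul_unitE b) => _ _ ->.
move: b bL; apply: Rsp_ind => [|k u v uL vL||u v].
- by rewrite (linear_zero (mulopE_linr _)) mem0v.
- by rewrite mulopE_linr memvD // memvZ.
- by case: (mul_unitE (rho x y)) => _ _ _ ->; apply: rho_in.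
by rewrite mul_rho rho_in.
Qed.

Lemma barL_in a : a \in Lsp -> barE a \in Lsp.
Proof.
move: a; apply: Lsp_ind => [|k u v uL vL||x y]; first exact: mem0v.
- by rewrite (_ : barE _ = k *: barE u + barE v) // memvD // memvZ.
- exact: unitL_in.
exact: lambda_in y x.
Qed.

Lemma barR_in a : a \in Rsp -> barE a \in Rsp.
Proof.
move: a; apply: Rsp_ind => [|k u v uL vL||x y]; first exact: mem0v.
- by rewrite (_ : barE _ = k *: barE u + barE v) // memvD // memvZ.
- exact: unitR_in.
exact: rho_in y x.
Qed.

Definition Lalg : vectType F := subvs_of Lsp.
Definition Ralg : vectType F := subvs_of Rsp.

Definition mulL (a b : Lalg) : Lalg := Subvs (mulL_in (subvsP a) (subvsP b)).
Definition mulR (a b : Ralg) : Ralg := Subvs (mulR_in (subvsP a) (subvsP b)).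
Definition barL (a : Lalg) : Lalg := Subvs (barL_in (subvsP a)).
Definition barR (b : Ralg) : Ralg := Subvs (barR_in (subvsP b)).
Definition oneL : Lalg := Subvs unitL_in.
Definition oneR : Ralg := Subvs unitR_in.
Definition lambdaL x y : Lalg := Subvs (lambda_in x y).
Definition rhoR x y : Ralg := Subvs (rho_in x y).

(* The matrix with rows (a, x) and (y, b) is the pair of pairs
   ((a, x), (y, b)). *)
Definition calA : vectType F := ((Lalg * W) * (W * Ralg))%type.

Definition mulA (p q : calA) : calA :=
  let: ((a, x), (y, b)) := p in
  let: ((a', x'), (y', b')) := q in
  ((mulL a a' + lambdaL x y', (vsval a).1 x' + (vsval b').1 x),
   ((vsval a').2 y + (vsval b).2 y', rhoR y x' + mulR b b')).

Definition oneA : calA := ((oneL, 0), (0, oneR)).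

Definition phiA (p : calA) : calA :=
  let: ((a, x), (y, b)) := p in ((barL a, y), (x, barR b)).

Definition inW (w : W) : calA := ((0, w), (0, 0)).
Definition prW (p : calA) : W := p.1.2.

Lemma linear_add (U V : lmodType F) (f : U -> V) :
  linear f -> forall u v, f (u + v) = f u + f v.
Proof. by move=> fl u v; have := fl 1 u v; rewrite !scale1r. Qed.

Lemma mulEopA : associative mulEop.
Proof. by move=> a b c; rewrite /mulEop /= !comp_lfunA. Qed.

Lemma mulopEA : associative mulopE.
Proof. by move=> a b c; rewrite /mulopE /= !comp_lfunA. Qed.

Lemma actL_lambda a : a \in Lsp -> forall x y,
  mulEop a (lambda x y) = lambda (a.1 x) y /\
  mulEop (lambda x y) a = lambda x (a.2 y).
Proof.
move: a; apply: Lsp_ind => [|k u v uP vP||u v] x y.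
- rewrite (linear_zero (mulEop_linl _)) (linear_zero (mulEop_linr _)) /=.
  by rewrite !lfunE /= (linear_zero (lambda_linl _)) (linear_zero (lambda_linr _)).
- rewrite mulEop_linl mulEop_linr /= !add_lfunE !scale_lfunE.
  rewrite lambda_linl lambda_linr.
  by have [-> ->] := uP x y; have [-> ->] := vP x y.
- by have [-> -> _ _] := mul_unitE (lambda x y); rewrite /= !id_lfunE.
rewrite !mul_lambda /= !lopE; split=> //.
by congr (_, _); apply/lfunP => z; rewrite !lopE !(triple_as12, triple_as23).
Qed.

Lemma actR_rho b : b \in Rsp -> forall x y,
  mulopE b (rho x y) = rho (b.2 x) y /\
  mulopE (rho x y) b = rho x (b.1 y).
Proof.
move: b; apply: Rsp_ind => [|k u v uP vP||u v] x y.
- rewrite (linear_zero (mulopE_linl _)) (linear_zero (mulopE_linr _)) /=.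
  by rewrite !lfunE /= (linear_zero (rho_linl _)) (linear_zero (rho_linr _)).
- rewrite mulopE_linl mulopE_linr /= !add_lfunE !scale_lfunE.
  rewrite rho_linl rho_linr.
  by have [-> ->] := uP x y; have [-> ->] := vP x y.
- by have [_ _ -> ->] := mul_unitE (rho x y); rewrite /= !id_lfunE.
rewrite !mul_rho /= !ropE; split=> //.
congr (_, _); apply/lfunP => z; rewrite !ropE.
  by rewrite !(triple_as12, triple_as23).
by rewrite !(triple_as12, triple_as23).
Qed.

Lemma lambda_bal b : b \in Rsp -> forall x y,
  lambda (b.1 x) y = lambda x (b.2 y).
Proof.
move: b; apply: Rsp_ind => [|k u v uP vP||u v] x y.
- by rewrite /= !lfunE /= (linear_zero (lambda_linl _)) (linear_zero (lambda_linr _)).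
- by rewrite /= !add_lfunE !scale_lfunE lambda_linl lambda_linr uP vP.
- by rewrite /= !id_lfunE.
rewrite /= !ropE; congr (_, _); apply/lfunP => z; rewrite !lopE.
  by rewrite !(triple_as12, triple_as23).
by rewrite !(triple_as12, triple_as23).
Qed.

Lemma rho_bal a : a \in Lsp -> forall x y,
  rho (a.2 x) y = rho x (a.1 y).
Proof.
move: a; apply: Lsp_ind => [|k u v uP vP||u v] x y.
- by rewrite /= !lfunE /= (linear_zero (rho_linl _)) (linear_zero (rho_linr _)).
- by rewrite /= !add_lfunE !scale_lfunE rho_linl rho_linr uP vP.
- by rewrite /= !id_lfunE.
rewrite /= !lopE; congr (_, _); apply/lfunP => z; rewrite !ropE.
  by rewrite !(triple_as12, triple_as23).
by rewrite !(triple_as12, triple_as23).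
Qed.

Lemma actLR a b : a \in Lsp -> b \in Rsp ->
  (forall x, a.1 (b.1 x) = b.1 (a.1 x)) /\
  (forall x, a.2 (b.2 x) = b.2 (a.2 x)).
Proof.
move=> aL bR; move: a aL; apply: Lsp_ind => [|k u v [u1 u2] [v1 v2]||u v].
- by split=> x; rewrite !lfunE /= linear0.
- by split=> x; rewrite !add_lfunE !scale_lfunE ?u1 ?v1 ?u2 ?v2 linearP.
- by split=> x; rewrite !id_lfunE.
move: b bR; apply: Rsp_ind => [|k a b [u1 u2] [v1 v2]||a b].
- by split=> x; rewrite !lfunE /= linear0.
- by split=> x; rewrite !(add_lfunE, scale_lfunE) linearP -?u1 -?u2 -?v1 -?v2.
- by split=> x; rewrite !id_lfunE.
by split=> x; rewrite /= !lopE !ropE !(triple_as12, triple_as23).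
Qed.

Lemma mulA1l : left_id oneA mulA.
Proof.
move=> [[a x] [y b]]; rewrite /mulA /=.
rewrite !id_lfunE !(linear0, add0r, addr0).
congr ((_, _), (_, _)); apply: val_inj => /=.
  rewrite (linear_zero (lambda_linl _)) addr0.
  by case: (mul_unitE (vsval a)).
rewrite (linear_zero (rho_linl _)) add0r.
by case: (mul_unitE (vsval b)).
Qed.

Lemma mulA1r : right_id oneA mulA.
Proof.
move=> [[a x] [y b]]; rewrite /mulA /=.
rewrite !id_lfunE !(linear0, add0r, addr0).
congr ((_, _), (_, _)); apply: val_inj => /=.
  rewrite (linear_zero (lambda_linr _)) addr0.
  by case: (mul_unitE (vsval a)).
rewrite (linear_zero (rho_linr _)) add0r.
by case: (mul_unitE (vsval b)).
Qed.

Lemma mulAA : associative mulA.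
Proof.
move=> [[[a aL] x] [y [b bR]]] [[[a' aL'] x'] [y' [b' bR']]].
move=> [[[a'' aL''] x''] [y'' [b'' bR'']]].
have mEl u := linear_add (mulEop_linl u).
have mEr u := linear_add (mulEop_linr u).
have mRl u := linear_add (mulopE_linl u).
have mRr u := linear_add (mulopE_linr u).
have lDl u := linear_add (lambda_linl u).
have lDr u := linear_add (lambda_linr u).
have rDl u := linear_add (rho_linl u).
have rDr u := linear_add (rho_linr u).
have [lr _] := actLR aL bR''; have [_ lr'] := actLR aL'' bR.
rewrite /mulA; congr ((_, _), (_, _)).
- apply: val_inj; rewrite /= mEr mEl mulEopA lDr lDl !addrA.
  have [-> _] := actL_lambda aL x' y''.
  have [_ ->] := actL_lambda aL'' x y'.
  rewrite (lambda_bal bR') -!addrA; congr (_ + _).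
  by rewrite addrC -addrA; congr (_ + _); rewrite addrC.
- rewrite /= !linearD /= !add_lfunE !comp_lfunE lr.
  by rewrite !lopE !ropE addrACA !addrA.
- rewrite /= !linearD /= !add_lfunE !comp_lfunE lr'.
  by rewrite !lopE !ropE addrACA !addrA.
apply: val_inj; rewrite /= mRr mRl mulopEA rDr rDl !addrA.
have [-> _] := actR_rho bR y' x''.
have [_ ->] := actR_rho bR'' y x'.
rewrite (rho_bal aL'); congr (_ + _).
by rewrite addrAC.
Qed.

Lemma phiAK : involutive phiA.
Proof.
by move=> [[a x] [y b]]; congr ((_, _), (_, _)); apply: val_inj => /=;
   case: (vsval _).
Qed.

Lemma phiAM p q : phiA (mulA p q) = mulA (phiA q) (phiA p).
Proof.
case: p q => [[a x] [y b]] [[a' x'] [y' b']].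
congr ((_, _), (_, _)).
  by apply: val_inj.
by apply: val_inj.
Qed.

Lemma tripleE u v w : inW (T u v w) = mulA (mulA (inW u) (phiA (inW v))) (inW w).
Proof.
have l0r c := linear_zero (lambda_linr c).
have r0l c := linear_zero (rho_linl c).
have ELr c := linear_zero (mulEop_linr c).
have ERr c := linear_zero (mulopE_linr c).
congr ((_, _), (_, _)); rewrite /=.
- by apply: val_inj; rewrite /= l0r addr0 ELr.
- by rewrite !add_lfunE lopE comp_lfunE !zero_lfunE add0r addr0.
- have rop00 : rop 0 0 = 0 := congr1 fst (r0l 0).
  by rewrite !zero_lfunE add_lfunE rop00 comp_lfunE !zero_lfunE !addr0.
by apply: val_inj; rewrite /= !zero_lfunE addr0 ERr addr0 r0l.
Qed.

Lemma mulA_linl q : linear (fun p => mulA p q).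
Proof.
case: q => [[a' x'] [y' b']] k [[a x] [y b]] [[c z] [t d]].
congr ((_, _), (_, _)).
- apply: val_inj; rewrite /= mulEop_linl lambda_linl scalerDr.
  exact: addrACA.
- by rewrite /= add_lfunE scale_lfunE linearP scalerDr addrACA.
- by rewrite /= add_lfunE scale_lfunE linearP scalerDr addrACA.
apply: val_inj; rewrite /= mulopE_linl rho_linl scalerDr.
exact: addrACA.
Qed.

Lemma mulA_linr p : linear (mulA p).
Proof.
case: p => [[a' x'] [y' b']] k [[a x] [y b]] [[c z] [t d]].
congr ((_, _), (_, _)).
- apply: val_inj; rewrite /= mulEop_linr lambda_linr scalerDr.
  exact: addrACA.
- by rewrite /= add_lfunE scale_lfunE linearP scalerDr addrACA.
- by rewrite /= add_lfunE scale_lfunE linearP scalerDr addrACA.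
apply: val_inj; rewrite /= mulopE_linr rho_linr scalerDr.
exact: addrACA.
Qed.

Lemma phiA_lin : linear phiA.
Proof.
move=> k [[a x] [y b]] [[c z] [t d]].
by congr ((_, _), (_, _)); apply: val_inj.
Qed.

Lemma inW_lin : linear inW.
Proof.
by move=> k x y; congr ((_, _), (_, _)); rewrite /= scaler0 addr0.
Qed.

Lemma prW_lin : linear prW.
Proof. by []. Qed.

End Loos.

Variant degree := deg_m1 | deg_0 | deg_1.

Definition homogA (F : fieldType) (W : vectType F) (T : at2 W)
    (d : degree) (p : calA T) : Prop :=
  let: ((a, x), (y, b)) := p in
  match d with
  | deg_m1 => [/\ a = 0, y = 0 & b = 0]
  | deg_0 => x = 0 /\ y = 0
  | deg_1 => [/\ a = 0, x = 0 & b = 0]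
  end.

(* A commutative associative unital F-algebra, given by its structure map; the
   zero algebra is included. *)
Record comalg (F : fieldType) := ComAlg {
  comalg_ring :> comPzRingType;
  comalg_in : {rmorphism F -> comalg_ring} }.

Record alghom (F : fieldType) (R S : comalg F) := AlgHom {
  alghom_fun :> {rmorphism R -> S};
  alghom_in : forall c, alghom_fun (comalg_in R c) = comalg_in S c }.

Definition alghom_id (F : fieldType) (R : comalg F) : alghom R R :=
  @AlgHom F R R (GRing.RMorphism.clone _ _ idfun _) (fun _ => erefl).

Lemma alghom_comp_in (F : fieldType) (R S U : comalg F)
    (beta : alghom S U) (alpha : alghom R S) c :
  (beta \o alpha) (comalg_in R c) = comalg_in U c.
Proof. by rewrite /= !alghom_in. Qed.

Definition alghom_comp (F : fieldType) (R S U : comalg F)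
    (beta : alghom S U) (alpha : alghom R S) : alghom R U :=
  @AlgHom F R U (GRing.RMorphism.clone _ _ (beta \o alpha) _)
    (alghom_comp_in beta alpha).

(* V (x)_F R, in the coordinates of the basis vbasis {:V}; the canonical map
   V -> V (x) R, v |-> v (x) 1 is tens, and ext_universal is the universal
   property. *)
Notation ext V R := ('rV[comalg_ring R]_(\dim (@fullv _ V))).

Section Extension.
Variable F : fieldType.
Implicit Types (R S : comalg F) (V : vectType F).

Definition bas V (i : 'I_(\dim {:V})) : V := (vbasis {:V})`_i.
Arguments bas : clear implicits.

Definition tens V R (v : V) : ext V R :=
  \row_i comalg_in R (coord (vbasis {:V}) i v).

Lemma tens_lin V R a (u v : V) :
  tens R (a *: u + v) = comalg_in R a *: tens R u + tens R v.
Proof. by apply/rowP => i; rewrite !mxE linearP rmorphD rmorphM. Qed.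

Lemma tens_bas V R i : tens R (bas V i) = delta_mx 0 i.
Proof.
apply/rowP => j; rewrite !mxE eqxx /= coord_free ?(basis_free (vbasisP _)) //.
by rewrite rmorph_nat eq_sym.
Qed.

Lemma ext_sum V R (x : ext V R) : x = \sum_i x 0 i *: tens R (bas V i).
Proof.
by rewrite [LHS]row_sum_delta; apply: eq_bigr => i _; rewrite tens_bas.
Qed.

Lemma bas_sum V (v : V) : v = \sum_i coord (vbasis {:V}) i v *: bas V i.
Proof. by apply: coord_vbasis; rewrite memvf. Qed.

Lemma ext_universal V R (M : lmodType R) (g : V -> M) :
    (forall a u v, g (a *: u + v) = comalg_in R a *: g u + g v) ->
  exists! h : ext V R -> M, linear h /\ forall v, h (tens R v) = g v.
Proof.
move=> gl; have g0 : g 0 = 0.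
  by have := gl (-1) 0 0; rewrite scaleN1r addNr rmorphN1 scaleN1r addNr.
have gsum (I : Type) (r : seq I) c (u : I -> V) :
    g (\sum_(i <- r) c i *: u i) = \sum_(i <- r) comalg_in R (c i) *: g (u i).
  elim: r => [|i r IHr]; first by rewrite !big_nil g0.
  by rewrite !big_cons gl IHr.
exists (fun x => \sum_i x 0 i *: g (bas V i)); split=> [|h [hl hg]].
  split=> [a x y|v].
    rewrite scaler_sumr -big_split; apply: eq_bigr => i _ /=.
    by rewrite !mxE scalerDl scalerA.
  by rewrite [in RHS](bas_sum v) gsum; apply: eq_bigr => i _; rewrite mxE.
apply: funext => x; rewrite [in RHS](ext_sum x).
pose hL := HB.pack_for {linear ext V R -> M} h
  (GRing.isLinear.Build R _ _ _ h hl).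
rewrite -[h]/(hL : _ -> _) linear_sum; apply: eq_bigr => i _.
by rewrite linearZ /= hg.
Qed.

(* R-multilinear extensions of F-multilinear maps: each is determined by its
   values on the vectors bas i, and agrees with f on the image of tens
   (ext1_tens, ext2_tens, ext3_tens). *)
Definition ext1 V V' R (f : V -> V') (x : ext V R) : ext V' R :=
  \sum_i x 0 i *: tens R (f (bas V i)).

Definition ext2 V1 V2 V' R (f : V1 -> V2 -> V') (x : ext V1 R) (y : ext V2 R) :
    ext V' R :=
  \sum_i x 0 i *: ext1 (f (bas V1 i)) y.

Definition ext3 V1 V2 V3 V' R (f : V1 -> V2 -> V3 -> V')
    (x : ext V1 R) (y : ext V2 R) (z : ext V3 R) : ext V' R :=
  \sum_i x 0 i *: ext2 (f (bas V1 i)) y z.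

(* U (x) R inside V (x) R, for a subspace U of V. *)
Definition ext_sub V R (U : V -> Prop) (x : ext V R) : Prop :=
  exists n (c : 'I_n -> R) (u : 'I_n -> V),
    (forall i, U (u i)) /\ x = \sum_i c i *: tens R (u i).

(* The S-linear extension to V (x) S of an R-linear map f of V (x) R, along
   alpha : R -> S. *)
Definition ext_end V R S (alpha : alghom R S) (f : ext V R -> ext V R)
    (x : ext V S) : ext V S :=
  \sum_i x 0 i *: map_mx alpha (f (tens R (bas V i))).


Lemma ext1_lin V V' R (f : V -> V') : linear (ext1 (R := R) f).
Proof.
move=> a x y; rewrite /ext1 scaler_sumr -big_split; apply: eq_bigr => i _ /=.
by rewrite !mxE scalerDl scalerA.
Qed.

Lemma ext2_linl V1 V2 V' R (f : V1 -> V2 -> V') y : linear (fun x => ext2 (R := R) f x y).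
Proof.
move=> a x x'; rewrite /ext2 scaler_sumr -big_split; apply: eq_bigr => i _ /=.
by rewrite !mxE scalerDl scalerA.
Qed.

Lemma ext2_linr V1 V2 V' R (f : V1 -> V2 -> V') x : linear (ext2 (R := R) f x).
Proof.
move=> a y y'; rewrite /ext2 scaler_sumr -big_split; apply: eq_bigr => i _ /=.
by rewrite (ext1_lin (f (bas V1 i)) a y y') scalerDr !scalerA mulrC.
Qed.

Lemma tens_sum V R (I : Type) (r : seq I) (c : I -> F) (u : I -> V) :
  tens R (\sum_(i <- r) c i *: u i) =
    \sum_(i <- r) comalg_in R (c i) *: tens R (u i).
Proof.
elim: r => [|i r IHr]; last by rewrite !big_cons tens_lin IHr.
by rewrite !big_nil; apply/rowP => j; rewrite !mxE linear0 rmorph0.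
Qed.

Lemma ext_sum_tens V R (M : lmodType F) (N : lmodType R) (f : V -> M)
    (g : M -> N) :
    (forall (I : Type) (r : seq I) c (u : I -> M),
       g (\sum_(i <- r) c i *: u i) =
         \sum_(i <- r) comalg_in R (c i) *: g (u i)) ->
  linear f -> forall v,
    \sum_i tens R v 0 i *: g (f (bas V i)) = g (f v).
Proof.
move=> gsum fl v; rewrite [in RHS](bas_sum v).
have f0 := linear_zero fl.
have -> (r : seq _) : f (\sum_(i <- r) coord (vbasis {:V}) i v *: bas V i) =
    \sum_(i <- r) coord (vbasis {:V}) i v *: f (bas V i).
  by elim: r => [|i r IHr]; rewrite ?big_nil // !big_cons fl IHr.
by rewrite gsum; apply: eq_bigr => i _; rewrite mxE.
Qed.

Lemma ext1_tens V V' R (f : V -> V') : linear f ->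
  forall v, ext1 f (tens R v) = tens R (f v).
Proof. by move=> fl v; apply: (ext_sum_tens (@tens_sum _ R) fl). Qed.

Section ExtTheory.
Variables (V1 V2 V3 V' : vectType F) (R : comalg F).

Lemma ext3_lin1 (f : V1 -> V2 -> V3 -> V') y z :
  linear (fun x => ext3 (R := R) f x y z).
Proof.
move=> a x x'; rewrite /ext3 scaler_sumr -big_split; apply: eq_bigr => i _ /=.
by rewrite !mxE scalerDl scalerA.
Qed.

Lemma ext3_lin2 (f : V1 -> V2 -> V3 -> V') x z :
  linear (fun y => ext3 (R := R) f x y z).
Proof.
move=> a y y'; rewrite /ext3 scaler_sumr -big_split; apply: eq_bigr => i _ /=.
by rewrite (ext2_linl (f (bas V1 i)) z a y y') scalerDr !scalerA mulrC.
Qed.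

Lemma ext3_lin3 (f : V1 -> V2 -> V3 -> V') x y :
  linear (ext3 (R := R) f x y).
Proof.
move=> a z z'; rewrite /ext3 scaler_sumr -big_split; apply: eq_bigr => i _ /=.
by rewrite (ext2_linr (f (bas V1 i)) y a z z') scalerDr !scalerA mulrC.
Qed.

End ExtTheory.

Lemma ext2_tens V1 V2 V' R (f : V1 -> V2 -> V') :
    (forall y, linear (f ^~ y)) -> (forall x, linear (f x)) ->
  forall u v, ext2 f (tens R u) (tens R v) = tens R (f u v).
Proof.
move=> fl fr u v; rewrite /ext2.
under eq_bigr do rewrite ext1_tens //.
exact: (ext_sum_tens (@tens_sum _ R) (fl v)).
Qed.

Lemma ext3_tens V1 V2 V3 V' R (f : V1 -> V2 -> V3 -> V') :
    (forall y z, linear (fun x => f x y z)) ->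
    (forall x z, linear (fun y => f x y z)) -> (forall x y, linear (f x y)) ->
  forall u v w, ext3 f (tens R u) (tens R v) (tens R w) = tens R (f u v w).
Proof.
move=> f1 f2 f3 u v w; rewrite /ext3.
under eq_bigr do rewrite ext2_tens //.
exact: (ext_sum_tens (@tens_sum _ R) (f1 v w)).
Qed.

Section ExtMap.
Variables (R S : comalg F) (alpha : alghom R S).

Lemma map_tens V (v : V) : map_mx alpha (tens R v) = tens S v.
Proof. by apply/rowP => i; rewrite !mxE alghom_in. Qed.

Lemma map_sum_ext V (I : Type) (r : seq I) (c : I -> R) (u : I -> ext V R) :
  map_mx alpha (\sum_(i <- r) c i *: u i) =
    \sum_(i <- r) alpha (c i) *: map_mx alpha (u i).
Proof.
elim: r => [|i r IHr]; first by rewrite !big_nil map_mx0.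
by rewrite !big_cons map_mxD map_mxZ IHr.
Qed.

Lemma map_ext1 V V' (f : V -> V') x :
  map_mx alpha (ext1 f x) = ext1 f (map_mx alpha x).
Proof.
by rewrite map_sum_ext; apply: eq_bigr => i _; rewrite map_tens mxE.
Qed.

Lemma map_ext2 V1 V2 V' (f : V1 -> V2 -> V') x y :
  map_mx alpha (ext2 f x y) = ext2 f (map_mx alpha x) (map_mx alpha y).
Proof.
by rewrite map_sum_ext; apply: eq_bigr => i _; rewrite map_ext1 mxE.
Qed.

Lemma map_ext3 V1 V2 V3 V' (f : V1 -> V2 -> V3 -> V') x y z :
  map_mx alpha (ext3 f x y z) =
    ext3 f (map_mx alpha x) (map_mx alpha y) (map_mx alpha z).
Proof.
by rewrite map_sum_ext; apply: eq_bigr => i _; rewrite map_ext2 mxE.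
Qed.

Lemma ext_end_lin V (f : ext V R -> ext V R) : linear (ext_end alpha f).
Proof.
move=> a x y; rewrite /ext_end scaler_sumr -big_split.
by apply: eq_bigr => i _ /=; rewrite !mxE scalerDl scalerA.
Qed.

Lemma ext_endE V (f : ext V R -> ext V R) : linear f ->
  forall x, ext_end alpha f (map_mx alpha x) = map_mx alpha (f x).
Proof.
move=> fl x; have f0 := linear_zero fl.
have fsum (r : seq 'I_(\dim {:V})) :
    f (\sum_(i <- r) x 0 i *: tens R (bas V i)) =
      \sum_(i <- r) x 0 i *: f (tens R (bas V i)).
  by elim: r => [|i r IHr]; rewrite ?big_nil // !big_cons fl IHr.
rewrite [in RHS](ext_sum x) fsum map_sum_ext.
by apply: eq_bigr => i _; rewrite mxE.
Qed.

Lemma ext_eqP V (M : lmodType S) (f g : ext V S -> M) :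
  linear f -> linear g -> (forall i, f (tens S (bas V i)) = g (tens S (bas V i))) ->
  f =1 g.
Proof.
move=> fl gl fg x; rewrite (ext_sum x).
have f0 := linear_zero fl; have g0 := linear_zero gl.
elim: (index_enum _) => [|i r IHr]; first by rewrite !big_nil f0 g0.
by rewrite !big_cons fl gl IHr fg.
Qed.

End ExtMap.
End Extension.
Arguments bas {F} V i.

Record group_functor (F : fieldType) := GroupFunctor {
  gf_obj :> comalg F -> groupType;
  gf_map : forall R S : comalg F, alghom R S -> gf_obj R -> gf_obj S;
  gf_mapM : forall (R S : comalg F) (alpha : alghom R S),
    {morph gf_map alpha : x y / (x * y)%g};
  gf_map_id : forall (R : comalg F) (x : gf_obj R),
    gf_map (alghom_id R) x = x;
  gf_map_comp : forall (R S U : comalg F) (beta : alghom S U)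
      (alpha : alghom R S) (x : gf_obj R),
    gf_map (alghom_comp beta alpha) x = gf_map beta (gf_map alpha x) }.
Arguments gf_map {F} g {R S}.

Record gf_morphism (F : fieldType) (G H : group_functor F) := GfMorphism {
  gf_fun :> forall R : comalg F, G R -> H R;
  gf_funM : forall R : comalg F, {morph @gf_fun R : x y / (x * y)%g};
  gf_fun_nat : forall (R S : comalg F) (alpha : alghom R S) (x : G R),
    @gf_fun S (gf_map G alpha x) = gf_map H alpha (@gf_fun R x) }.

Arguments gf_fun {F G H} g R.

Definition affine (F : fieldType) (G : group_functor F) : Prop :=
  exists (A : comalg F) (Y : forall R : comalg F, alghom A R -> G R),
    (forall R, bijective (Y R)) /\
    (forall (R S : comalg F) (alpha : alghom R S) (chi : alghom A R),
       Y S (alghom_comp alpha chi) = gf_map G alpha (Y R chi)).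

(* Families of properties of R-linear endomorphisms of V (x) R that cut out
   subgroups of GL(V (x) R) stable under extension of scalars. *)
Record autfam (F : fieldType) (V : vectType F) := AutFam {
  af_pred :> forall R : comalg F, (ext V R -> ext V R) -> Prop;
  af_id : forall R, af_pred (R := R) id;
  af_comp : forall R (f g : ext V R -> ext V R),
    af_pred f -> af_pred g -> af_pred (f \o g);
  af_inv : forall R (f g : ext V R -> ext V R),
    cancel f g -> cancel g f -> af_pred f -> af_pred g;
  af_ext : forall (R S : comalg F) (alpha : alghom R S)
      (f g : ext V R -> ext V R),
    linear f -> linear g -> cancel f g -> cancel g f -> af_pred f ->
    af_pred (ext_end alpha f) }.

Section AutGroup.
Variables (F : fieldType) (V : vectType F) (P : autfam V).

Record autgrp (R : comalg F) := AutGrp {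
  autfun :> ext V R -> ext V R;
  autfunP : [/\ linear autfun, bijective autfun & P R autfun] }.

Section OneRing.
Variable R : comalg F.
Implicit Types f g h : autgrp R.

Lemma autgrp_eq f g : f =1 g -> f = g.
Proof.
case: f g => f fP [g gP] /= /funext fg; rewrite fg in fP *.
by congr AutGrp; apply: Prop_irrelevance.
Qed.

Lemma aut_id_subproof :
  [/\ linear (@id (ext V R)), bijective (@id (ext V R)) & P R id].
Proof. by split=> //; [exists id | apply: af_id]. Qed.
Definition aut_id := AutGrp aut_id_subproof.

Lemma aut_comp_subproof f g :
  [/\ linear (f \o g), bijective (f \o g) & P R (f \o g)].
Proof.
have [fl fb fP] := autfunP f; have [gl gb gP] := autfunP g; split.
- by move=> a x y; rewrite /= gl fl.
- exact: bij_comp.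
exact: af_comp.
Qed.
Definition aut_comp f g := AutGrp (aut_comp_subproof f g).

Lemma aut_inv_ex f : exists g : ext V R -> ext V R, cancel f g /\ cancel g f.
Proof. by have [_ [g fg gf] _] := autfunP f; exists g. Qed.

Definition aut_inv_fun f := sval (cid (aut_inv_ex f)).

Lemma aut_inv_funK f : cancel f (aut_inv_fun f) /\ cancel (aut_inv_fun f) f.
Proof. exact: svalP (cid (aut_inv_ex f)). Qed.

Lemma inv_lin (f g : ext V R -> ext V R) :
  linear f -> cancel f g -> cancel g f -> linear g.
Proof.
by move=> fl fg gf a x y; rewrite -[in LHS](gf x) -[in LHS](gf y) -fl fg.
Qed.

Lemma aut_inv_subproof f :
  [/\ linear (aut_inv_fun f), bijective (aut_inv_fun f) & P R (aut_inv_fun f)].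
Proof.
have [fg gf] := aut_inv_funK f; have [fl _ fP] := autfunP f; split.
- exact: inv_lin fl fg gf.
- by exists f.
exact: af_inv fg gf fP.
Qed.
Definition aut_inv f := AutGrp (aut_inv_subproof f).

Lemma aut_compA : associative aut_comp.
Proof. by move=> f g h; apply: autgrp_eq. Qed.
Lemma aut_comp1l : left_id aut_id aut_comp.
Proof. by move=> f; apply: autgrp_eq. Qed.
Lemma aut_comp1r : right_id aut_id aut_comp.
Proof. by move=> f; apply: autgrp_eq. Qed.
Lemma aut_compVl : left_inverse aut_id aut_inv aut_comp.
Proof. by move=> f; apply: autgrp_eq => x /=; apply: (aut_inv_funK f).1. Qed.
Lemma aut_compVr : right_inverse aut_id aut_inv aut_comp.
Proof. by move=> f; apply: autgrp_eq => x /=; apply: (aut_inv_funK f).2. Qed.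

HB.instance Definition _ := gen_eqMixin (autgrp R).
HB.instance Definition _ := gen_choiceMixin (autgrp R).
HB.instance Definition _ := isGroup.Build (autgrp R)
  aut_compA aut_comp1l aut_comp1r aut_compVl aut_compVr.

End OneRing.

Lemma aut_map_subproof (R S : comalg F) (alpha : alghom R S) (f : autgrp R) :
  [/\ linear (ext_end alpha f), bijective (ext_end alpha f)
    & P S (ext_end alpha f)].
Proof.
have [fl _ fP] := autfunP f; have [gl _ _] := autfunP (aut_inv f).
have [fg gf] := aut_inv_funK f.
have ext_can (h k : ext V R -> ext V R) : linear h -> linear k -> cancel h k ->
    cancel (ext_end alpha h) (ext_end alpha k).
  move=> hl kl hk; apply: (ext_eqP (f := ext_end alpha k \o ext_end alpha h)).
  - by move=> a x y; rewrite /= !ext_end_lin.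
  - by [].
  by move=> i; rewrite /= -(map_tens alpha) ext_endE // ext_endE // hk.
split; first exact: ext_end_lin.
  by exists (ext_end alpha (aut_inv f)); apply: ext_can.
exact: (af_ext alpha fl gl fg gf fP).
Qed.
Definition aut_map (R S : comalg F) (alpha : alghom R S) (f : autgrp R) :=
  AutGrp (aut_map_subproof alpha f).

Lemma aut_mapM (R S : comalg F) (alpha : alghom R S) :
  {morph aut_map alpha : f g / (f * g)%g}.
Proof.
move=> f g; apply: autgrp_eq => x /=.
have [fl _ _] := autfunP f; have [gl _ _] := autfunP g.
apply: (ext_eqP (g := ext_end alpha f \o ext_end alpha g)) => [||i].
- exact: ext_end_lin.
- by move=> a y z; rewrite /= !ext_end_lin.
rewrite /= -(map_tens alpha) ext_endE; last by case: (autfunP (f * g)%g).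
by rewrite !ext_endE.
Qed.

Lemma aut_map_id (R : comalg F) (f : autgrp R) : aut_map (alghom_id R) f = f.
Proof.
have [fl _ _] := autfunP f; apply: autgrp_eq.
apply: ext_eqP => [||i] //; first exact: ext_end_lin.
rewrite /= -[in LHS](map_tens (alghom_id R)) ext_endE //.
by apply/rowP => j; rewrite mxE.
Qed.

Lemma aut_map_comp (R S U : comalg F) (beta : alghom S U) (alpha : alghom R S)
    (f : autgrp R) :
  aut_map (alghom_comp beta alpha) f = aut_map beta (aut_map alpha f).
Proof.
have [fl _ _] := autfunP f; apply: autgrp_eq.
apply: ext_eqP => [||i]; [exact: ext_end_lin | exact: ext_end_lin | ].
rewrite /= -[in LHS](map_tens (alghom_comp beta alpha)) ext_endE //.
rewrite -[in RHS](map_tens beta) ext_endE; last exact: ext_end_lin.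
rewrite -(map_tens alpha) ext_endE //.
by apply/rowP => j; rewrite !mxE.
Qed.

Definition aut_functor : group_functor F :=
  @GroupFunctor F (fun R => autgrp R : groupType)
    aut_map aut_mapM aut_map_id aut_map_comp.

End AutGroup.

Section Schemes.
Variables (F : fieldType) (W : vectType F) (T : at2 W).
Implicit Types R S : comalg F.

Definition triple_aut R (f : ext W R -> ext W R) : Prop :=
  forall x y z, f (ext3 T x y z) = ext3 T (f x) (f y) (f z).

Definition AR_one R : ext (calA T) R := tens R (oneA T).
Definition AR_mul R : ext (calA T) R -> ext (calA T) R -> ext (calA T) R :=
  ext2 (@mulA _ _ T).
Definition AR_phi R : ext (calA T) R -> ext (calA T) R := ext1 (@phiA _ _ T).
Definition AR_homog R (d : degree) : ext (calA T) R -> Prop :=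
  ext_sub (@homogA _ _ T d).

(* AR_inW identifies W (x) R with the component of degree -1
   (AR_homog_m1P), with inverse AR_prW. *)
Definition AR_inW R : ext W R -> ext (calA T) R := ext1 (inW T).
Definition AR_prW R : ext (calA T) R -> ext W R := ext1 (@prW _ _ T).

Definition calA_aut R (f : ext (calA T) R -> ext (calA T) R) : Prop :=
  [/\ f (AR_one R) = AR_one R,
      forall x y, f (AR_mul x y) = AR_mul (f x) (f y),
      forall x, f (AR_phi x) = AR_phi (f x)
    & forall d x, AR_homog d x <-> AR_homog d (f x)].

Lemma triple_aut_id R : @triple_aut R id. Proof. by []. Qed.

Lemma triple_aut_comp R (f g : ext W R -> ext W R) :
  triple_aut f -> triple_aut g -> triple_aut (f \o g).
Proof. by move=> fP gP x y z; rewrite /= gP fP. Qed.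

Lemma triple_aut_inv R (f g : ext W R -> ext W R) :
  cancel f g -> cancel g f -> triple_aut f -> triple_aut g.
Proof. by move=> fg gf fP x y z; apply: (can_inj fg); rewrite fP !gf. Qed.

Lemma triple_aut_ext R S (alpha : alghom R S) (f g : ext W R -> ext W R) :
  linear f -> linear g -> cancel f g -> cancel g f -> triple_aut f ->
  triple_aut (ext_end alpha f).
Proof.
move=> fl _ _ _ fP x y z; set h := ext_end alpha f.
have hl : linear h by apply: ext_end_lin.
move: x; apply: ext_eqP => [a u v|a u v|i].
- by rewrite (ext3_lin1 (triple T) y z) hl.
- by rewrite hl (ext3_lin1 (triple T) (h y) (h z)).
move: y; apply: ext_eqP => [a u v|a u v|j].
- by rewrite (ext3_lin2 (triple T) _ z) hl.
- by rewrite hl (ext3_lin2 (triple T) _ (h z)).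
move: z; apply: ext_eqP => [a u v|a u v|k].
- by rewrite (ext3_lin3 (triple T)) hl.
- by rewrite hl (ext3_lin3 (triple T)).
by rewrite -!(map_tens alpha) -map_ext3 /h !ext_endE // fP map_ext3.
Qed.

Definition triple_autfam : autfam W :=
  AutFam triple_aut_id triple_aut_comp triple_aut_inv triple_aut_ext.

Lemma calA_aut_id R : @calA_aut R id. Proof. by []. Qed.

Lemma calA_aut_comp R (f g : ext (calA T) R -> ext (calA T) R) :
  calA_aut f -> calA_aut g -> calA_aut (f \o g).
Proof.
move=> [f1 fM fphi fd] [g1 gM gphi gd]; split=> /= [|x y|x|d x].
- by rewrite g1 f1.
- by rewrite gM fM.
- by rewrite gphi fphi.
by rewrite (gd d x); apply: fd.
Qed.

Lemma calA_aut_inv R (f g : ext (calA T) R -> ext (calA T) R) :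
  cancel f g -> cancel g f -> calA_aut f -> calA_aut g.
Proof.
move=> fg gf [f1 fM fphi fd]; split=> [|x y|x|d x].
- by rewrite -[in LHS]f1 fg.
- by apply: (can_inj fg); rewrite fM !gf.
- by apply: (can_inj fg); rewrite fphi !gf.
by rewrite (fd d (g x)) gf.
Qed.

Lemma AR_homog_lin R d (I : Type) (r : seq I) (c : I -> R) u :
    (forall i, AR_homog d (u i)) ->
  AR_homog d (\sum_(i <- r) c i *: u i).
Proof.
move=> ud; elim: r => [|i r [n [b [v [vd rE]]]]].
  exists 0%N, (fun _ => 0), (fun _ => 0); split=> [[]//|].
  by rewrite big_nil big_ord0.
have [m [b' [v' [vd' ui]]]] := ud i; rewrite big_cons rE ui.
exists (m + n)%N.
exists (fun j => match split j with inl k => c i * b' k | inr k => b k end).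
exists (fun j => match split j with inl k => v' k | inr k => v k end).
split=> [j|]; first by case: (split j).
rewrite big_split_ord scaler_sumr; congr (_ + _); apply: eq_bigr => j _.
  by rewrite scalerA; case: splitP => k /= => [/ord_inj -> // | jk];
     have := ltn_ord j; rewrite jk ltnNge leq_addr.
case: splitP => k /= jk; last by move/addnI/ord_inj: jk => ->.
by have := ltn_ord k; rewrite -jk ltnNge leq_addr.
Qed.

Lemma AR_homog_m1P R (x : ext (calA T) R) :
  AR_homog deg_m1 x <-> exists w, x = AR_inW w.
Proof.
split=> [[n [c [u [ud ->]]]]|[w ->]]; last first.
  exists (\dim {:W}), (fun i => w 0 i), (fun i => inW T (bas W i)).
  by split.
have uE i : tens R (u i) = AR_inW (tens R (prW (u i))).
  rewrite /AR_inW (ext1_tens _ (@inW_lin _ _ T)).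
  by have := ud i; case: (u i) => [[a z] [y b]] [/= -> -> ->].
exists (\sum_i c i *: tens R (prW (u i))).
have hl : linear (@AR_inW R) := ext1_lin (inW T).
elim: (index_enum _) => [|i r IHr]; first by rewrite !big_nil (linear_zero hl).
by rewrite !big_cons hl IHr uE.
Qed.

Lemma ext_end_homog R S (alpha : alghom R S)
    (f : ext (calA T) R -> ext (calA T) R) d :
    linear f -> (forall x, AR_homog d x -> AR_homog d (f x)) ->
  forall x, AR_homog d x -> AR_homog d (ext_end alpha f x).
Proof.
move=> fl fd _ [n [c [u [ud ->]]]]; set h := ext_end alpha f.
have hl : linear h by apply: ext_end_lin.
have -> : h (\sum_i c i *: tens S (u i)) = \sum_i c i *: h (tens S (u i)).
  elim: (index_enum _) => [|i r IHr]; first by rewrite !big_nil (linear_zero hl).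
  by rewrite !big_cons hl IHr.
apply: AR_homog_lin => i; rewrite -(map_tens alpha) /h ext_endE //.
have [|m [b [v [vd ->]]]] := fd (tens R (u i)).
  by exists 1%N, (fun _ => 1), (fun _ => u i); rewrite big_ord1 scale1r.
rewrite map_sum_ext; exists m, (fun j => alpha (b j)), v; split=> //.
by apply: eq_bigr => j _; rewrite map_tens.
Qed.

Lemma calA_aut_ext R S (alpha : alghom R S)
    (f g : ext (calA T) R -> ext (calA T) R) :
  linear f -> linear g -> cancel f g -> cancel g f -> calA_aut f ->
  calA_aut (ext_end alpha f).
Proof.
move=> fl gl fg gf fP; have [g1 gM gphi gd] := calA_aut_inv fg gf fP.
have [f1 fM fphi fd] := fP.
set h := ext_end alpha f; set k := ext_end alpha g.
have hl : linear h by apply: ext_end_lin.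
have kl : linear k by apply: ext_end_lin.
have hk : cancel h k.
  apply: (ext_eqP (f := k \o h)) => [a x y||i] //=.
    by rewrite hl kl.
  by rewrite -(map_tens alpha) /h /k !ext_endE // fg.
split=> [|x y|x|d x].
- by rewrite /AR_one -(map_tens alpha) /h ext_endE // -/(AR_one R) f1.
- move: x; apply: ext_eqP => [a u v|a u v|i].
  + by rewrite /AR_mul (ext2_linl (@mulA _ _ T) y) hl.
  + by rewrite hl /AR_mul (ext2_linl (@mulA _ _ T) (h y)).
  move: y; apply: ext_eqP => [a u v|a u v|j].
  + by rewrite /AR_mul (ext2_linr (@mulA _ _ T)) hl.
  + by rewrite hl /AR_mul (ext2_linr (@mulA _ _ T)).
  rewrite /AR_mul -!(map_tens alpha) -map_ext2 /h !ext_endE //.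
  by rewrite [f _]fM map_ext2.
- move: x; apply: ext_eqP => [a u v|a u v|i].
  + by rewrite /AR_phi (ext1_lin (@phiA _ _ T)) hl.
  + by rewrite hl /AR_phi (ext1_lin (@phiA _ _ T)).
  rewrite /AR_phi -!(map_tens alpha) -map_ext1 /h !ext_endE //.
  by rewrite [f _]fphi map_ext1.
split=> [xd|hxd].
  by apply: ext_end_homog => // y; apply: (fd d y).1.
by rewrite -[x]hk; apply: ext_end_homog => // y; apply: (gd d y).1.
Qed.

Definition calA_autfam : autfam (calA T) :=
  AutFam calA_aut_id calA_aut_comp calA_aut_inv calA_aut_ext.

Definition AutW : group_functor F := aut_functor triple_autfam.
Definition AutA : group_functor F := aut_functor calA_autfam.

Definition AutW_fun R (psi : AutW R) : ext W R -> ext W R :=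
  autfun (psi : autgrp triple_autfam R).
Definition AutA_fun R (Psi : AutA R) : ext (calA T) R -> ext (calA T) R :=
  autfun (Psi : autgrp calA_autfam R).

Definition is_calA R (psi : ext W R -> ext W R)
    (Psi : ext (calA T) R -> ext (calA T) R) : Prop :=
  [/\ linear Psi,
      forall a, AR_homog deg_m1 a -> Psi a = AR_inW (psi (AR_prW a)),
      forall a, AR_homog deg_1 a ->
        Psi a = AR_phi (AR_inW (psi (AR_prW (AR_phi a))))
    & forall n (a b : 'I_n -> ext (calA T) R),
        (forall i, AR_homog deg_1 (a i)) /\ (forall i, AR_homog deg_m1 (b i)) \/
        (forall i, AR_homog deg_m1 (a i)) /\ (forall i, AR_homog deg_1 (b i)) ->
        Psi (\sum_i AR_mul (a i) (b i)) =
          \sum_i AR_mul (Psi (a i)) (Psi (b i))].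

End Schemes.

(* Main.v *)
(* An R-automorphism psi of W_R acts by conjugation on pairs of operators, and
   this preserves L_R and R_R.  An element of A(W)_R is determined by its
   off-diagonal entries and the four actions of its diagonal entries on W_R,
   because these observations are jointly injective over F and hence split.  So
   "q observes at psi(w) the psi-image of what p observes at w" is the graph of
   an automorphism, A(psi).  It is the only map as in the theorem because A(W)_0
   is spanned by products, that is, the unit lies in L_0 and in R_0: simplicity
   of W makes L_0 semiprime, and a finite-dimensional semiprime algebra has a
   unit.  Both group functors are cut out of GL by identities that can be tested
   on jointly injective families of base changes, so they are represented by
   the ring of terms in the matrix coordinates modulo equality at all points. *)
Require Import Defs.
From HB Require Import structures.
From mathcomp Require Import all_boot all_order all_algebra.
From mathcomp Require Import boolp.
Import Defs.

Set Implicit Arguments.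
Unset Strict Implicit.
Unset Printing Implicit Defensive.
Import GRing.Theory.
Local Open Scope ring_scope.

(** * Representability *)

Inductive term (F X : Type) :=
  | TVar of X | TConst of F | TOpp of term F X
  | TAdd of term F X & term F X | TMul of term F X & term F X.
Arguments TVar {F X}.
Arguments TConst {F X}.

HB.instance Definition _ (F X : Type) := gen_eqMixin (term F X).
HB.instance Definition _ (F X : Type) := gen_choiceMixin (term F X).

(* The coordinate ring of a functor with coordinates [c]: ring terms in the
   coordinates, identified when they agree at every point over every algebra.
   The points are then jointly injective, so that every identity, including the
   ring axioms, can be checked pointwise. *)
Section CoordinateRing.
Local Open Scope quotient_scope.
Variables (F : fieldType) (G : comalg F -> Type) (X : Type).
Variable c : forall R : comalg F, G R -> X -> R.

Fixpoint teval (R : comalg F) (v : X -> R) (t : term F X) : R :=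
  match t with
  | TVar i => v i
  | TConst k => comalg_in R k
  | TOpp t => - teval v t
  | TAdd t u => teval v t + teval v u
  | TMul t u => teval v t * teval v u
  end.

Definition same_values (t u : term F X) : Prop :=
  forall (R : comalg F) (g : G R), teval (c g) t = teval (c g) u.

Definition same_valuesb (t u : term F X) := `[< same_values t u >].

Fact same_values_refl : reflexive same_valuesb.
Proof. by move=> t; apply/asboolP. Qed.
Fact same_values_sym : symmetric same_valuesb.
Proof. by move=> t u; apply/asboolP/asboolP => tu R g; rewrite tu. Qed.
Fact same_values_trans : transitive same_valuesb.
Proof.
by move=> u t w /asboolP tu /asboolP uw; apply/asboolP => R g; rewrite tu uw.
Qed.

Canonical same_values_rel :=
  EquivRel same_valuesb same_values_refl same_values_sym same_values_trans.

Definition coordring := {eq_quot same_valuesb}.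
HB.instance Definition _ := Choice.on coordring.

Definition cr_class (t : term F X) : coordring := \pi t.

Definition cr_eval R (g : G R) (a : coordring) : R := teval (c g) (repr a).

Lemma cr_evalE R (g : G R) t : cr_eval g (cr_class t) = teval (c g) t.
Proof.
have /eqmodP/asboolP H : repr (cr_class t) = t %[mod coordring] by exact: reprK.
exact: H.
Qed.

Lemma cr_eval_inj a b :
  (forall (R : comalg F) (g : G R), cr_eval g a = cr_eval g b) -> a = b.
Proof.
by move=> ab; rewrite -[a]reprK -[b]reprK; apply/eqmodP/asboolP.
Qed.

Definition cr_add (a b : coordring) := cr_class (TAdd (repr a) (repr b)).
Definition cr_opp (a : coordring) := cr_class (TOpp (repr a)).
Definition cr_mul (a b : coordring) := cr_class (TMul (repr a) (repr b)).

Let evD R (g : G R) a b : cr_eval g (cr_add a b) = cr_eval g a + cr_eval g b.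
Proof. exact: cr_evalE. Qed.
Let evN R (g : G R) a : cr_eval g (cr_opp a) = - cr_eval g a.
Proof. exact: cr_evalE. Qed.
Let evM R (g : G R) a b : cr_eval g (cr_mul a b) = cr_eval g a * cr_eval g b.
Proof. exact: cr_evalE. Qed.
Let evC R (g : G R) k : cr_eval g (cr_class (TConst k)) = comalg_in R k.
Proof. exact: cr_evalE. Qed.
Let ev0 R (g : G R) : cr_eval g (cr_class (TConst 0)) = 0.
Proof. by rewrite evC rmorph0. Qed.
Let ev1 R (g : G R) : cr_eval g (cr_class (TConst 1)) = 1.
Proof. by rewrite evC rmorph1. Qed.
Let evE := (evD, evN, evM, ev0, ev1).

Fact cr_addA : associative cr_add.
Proof. by move=> x y z; apply: cr_eval_inj => R g; rewrite !evE addrA. Qed.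
Fact cr_addC : commutative cr_add.
Proof. by move=> x y; apply: cr_eval_inj => R g; rewrite !evE addrC. Qed.
Fact cr_add0 : left_id (cr_class (TConst 0)) cr_add.
Proof. by move=> x; apply: cr_eval_inj => R g; rewrite !evE add0r. Qed.
Fact cr_addN : left_inverse (cr_class (TConst 0)) cr_opp cr_add.
Proof. by move=> x; apply: cr_eval_inj => R g; rewrite !evE addNr. Qed.
Fact cr_mulA : associative cr_mul.
Proof. by move=> x y z; apply: cr_eval_inj => R g; rewrite !evE mulrA. Qed.
Fact cr_mulC : commutative cr_mul.
Proof. by move=> x y; apply: cr_eval_inj => R g; rewrite !evE mulrC. Qed.
Fact cr_mul1 : left_id (cr_class (TConst 1)) cr_mul.
Proof. by move=> x; apply: cr_eval_inj => R g; rewrite !evE mul1r. Qed.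
Fact cr_mulDl : left_distributive cr_mul cr_add.
Proof. by move=> x y z; apply: cr_eval_inj => R g; rewrite !evE mulrDl. Qed.

HB.instance Definition _ := GRing.isZmodule.Build coordring
  cr_addA cr_addC cr_add0 cr_addN.
HB.instance Definition _ := GRing.Zmodule_isComPzRing.Build coordring
  cr_mulA cr_mulC cr_mul1 cr_mulDl.

Definition cr_const (k : F) : coordring := cr_class (TConst k).

Fact cr_const_zmod : zmod_morphism cr_const.
Proof.
by move=> a b; apply: cr_eval_inj => R g; rewrite evD evN !evC rmorphB.
Qed.
Fact cr_const_monoid : monoid_morphism cr_const.
Proof.
by split=> [//|a b]; apply: cr_eval_inj => R g; rewrite evM !evC rmorphM.
Qed.
HB.instance Definition _ :=
  GRing.isZmodMorphism.Build F coordring cr_const cr_const_zmod.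
HB.instance Definition _ :=
  GRing.isMonoidMorphism.Build F coordring cr_const cr_const_monoid.

Definition coordalg : comalg F := @ComAlg F coordring cr_const.

Section Point.
Variables (R : comalg F) (g : G R).

Fact cr_eval_zmod : zmod_morphism (cr_eval g : coordalg -> R).
Proof. by move=> a b; rewrite evD evN. Qed.
Fact cr_eval_monoid : monoid_morphism (cr_eval g : coordalg -> R).
Proof. by split=> [|a b]; rewrite ?ev1 ?evM. Qed.
HB.instance Definition _ :=
  GRing.isZmodMorphism.Build coordalg R (cr_eval g) cr_eval_zmod.
HB.instance Definition _ :=
  GRing.isMonoidMorphism.Build coordalg R (cr_eval g) cr_eval_monoid.

Definition cr_point : alghom coordalg R :=
  @AlgHom F coordalg R (cr_eval g) (evC g).

End Point.

Definition cr_var (i : X) : coordalg := cr_class (TVar i).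

Lemma cr_point_var R (g : G R) i : cr_point g (cr_var i) = c g i.
Proof. exact: cr_evalE. Qed.

(** The variables thus generate the coordinate ring as an algebra over $F$, so that a homomorphism
    out of it is determined by their images. *)
Lemma cr_classE t : cr_class t = teval cr_var t.
Proof.
elim: t => [i|k|t IHt|t IHt u IHu|t IHt u IHu] //=; rewrite -?IHt -?IHu;
  by apply: cr_eval_inj => R g; rewrite ?evE !cr_evalE.
Qed.

Lemma teval_hom (R S : comalg F) (chi : alghom R S) v t :
  chi (teval v t) = teval (chi \o v) t.
Proof.
elim: t => [i|k|t IHt|t IHt u IHu|t IHt u IHu] //=.
- exact: alghom_in.
- by rewrite rmorphN IHt.
- by rewrite rmorphD IHt IHu.
by rewrite rmorphM IHt IHu.
Qed.

Lemma cr_hom_ext (R : comalg F) (chi chi' : alghom coordalg R) :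
  (forall i, chi (cr_var i) = chi' (cr_var i)) -> chi =1 chi'.
Proof.
move=> eqv a; rewrite -[a]reprK -/(cr_class _) cr_classE !teval_hom.
by congr teval; apply/funext => i; apply: eqv.
Qed.

End CoordinateRing.

Lemma alghom_eq (F : fieldType) (R S : comalg F) (f g : alghom R S) :
  f =1 g -> f = g.
Proof.
case: f g => [[f [[f1] [f2]]] fin] [[g [[g1] [g2]]] gin] /= /funext fg.
subst g.
have -> : g1 = f1 by apply: Prop_irrelevance.
have -> : g2 = f2 by apply: Prop_irrelevance.
congr AlgHom; exact: Prop_irrelevance.
Qed.

(** Yoneda with universal element [gam]: the base change of [gam] along a homomorphism has the
    images of the variables as coordinates, so [cr_point] inverts the correspondence. *)
Lemma affine_of_generic_point (F : fieldType) (G : group_functor F) (X : Type)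
    (c : forall R : comalg F, G R -> X -> R)
    (gam : G (coordalg c)) :
    (forall (R S : comalg F) (alpha : alghom R S) (g : G R) i,
      c S (gf_map G alpha g) i = alpha (c R g i)) ->
    (forall (R : comalg F) (g h : G R), c R g =1 c R h -> g = h) ->
    (forall i, c _ gam i = cr_var c i) ->
  affine G.
Proof.
move=> cnat cinj cgam.
exists (coordalg c), (fun R chi => gf_map G chi gam); split=> [R|R S alpha chi].
  exists (fun g => cr_point c g) => [chi|g].
    apply: alghom_eq; apply: cr_hom_ext => i.
    by rewrite cr_point_var cnat cgam.
  by apply: cinj => i; rewrite cnat cgam cr_point_var.
exact: gf_map_comp.
Qed.

(** The target [R] varies within the family; no single member need be injective. *)
Definition separating (F : fieldType) (A : comalg F)
    (D : forall R : comalg F, alghom A R -> Prop) : Prop :=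
  forall a b : A, (forall R (chi : alghom A R), D R chi -> chi a = chi b) -> a = b.

Lemma separating_ext (F : fieldType) (V : vectType F) (A : comalg F)
    (D : forall R : comalg F, alghom A R -> Prop) (x y : ext V A) :
    separating D ->
    (forall R (chi : alghom A R), D R chi -> map_mx chi x = map_mx chi y) ->
  x = y.
Proof.
move=> Dsep xy; apply/rowP => j; apply: Dsep => R chi /xy/rowP/(_ j).
by rewrite !mxE.
Qed.

(** * Automorphism functors in matrix coordinates *)

Section AutAffine.
Variables (F : fieldType) (V : vectType F) (P : autfam V).
Let n := \dim {:V}.

(** The rows are the images of the basis vectors, so maps act on row vectors from the right and
    composition reverses the order of the matrices. *)
Definition autmx (R : comalg F) (f : ext V R -> ext V R) : 'M[R]_n :=
  \matrix_(i, j) f (tens R (bas V i)) 0 j.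

Lemma mulmx_lin (R : comalg F) (M : 'M[R]_n) : linear (mulmx^~ M : ext V R -> ext V R).
Proof. by move=> a x y; rewrite mulmxDl scalemxAl. Qed.

Lemma autmxE (R : comalg F) (f : ext V R -> ext V R) :
  linear f -> forall x, f x = x *m autmx f.
Proof.
move=> fl; apply: ext_eqP => // [|i]; first exact: mulmx_lin.
by apply/rowP => j; rewrite tens_bas -rowE !mxE tens_bas.
Qed.

Lemma autmx_mul (R : comalg F) (f g : ext V R -> ext V R) :
  linear g -> autmx (g \o f) = autmx f *m autmx g.
Proof.
move=> gl; apply/matrixP => i j; rewrite !mxE /= autmxE // mxE.
by apply: eq_bigr => k _; rewrite [in RHS]mxE.
Qed.

Lemma autmx_id (R : comalg F) : autmx (@id (ext V R)) = 1%:M.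
Proof. by apply/matrixP => i j; rewrite mxE tens_bas !mxE eqxx eq_sym. Qed.

Lemma autmx_ext_end (R S : comalg F) (alpha : alghom R S) f : linear f ->
  autmx (ext_end alpha f) = map_mx alpha (autmx f).
Proof.
by move=> fl; apply/matrixP => i j; rewrite !mxE -(map_tens alpha) ext_endE // mxE.
Qed.

Lemma autmx_aut_inv (R : comalg F) (f : autgrp P R) :
  autmx (aut_inv f) *m autmx f = 1%:M /\ autmx f *m autmx (aut_inv f) = 1%:M.
Proof.
have [fl _ _] := autfunP f; have [gl _ _] := autfunP (aut_inv f).
have [fg gf] := aut_inv_funK f.
rewrite -!autmx_mul // -autmx_id.
by split; congr autmx; apply: funext.
Qed.

(** Base change is multiplicative, hence both sides are inverse to [aut_map alpha f]. *)
Lemma aut_inv_map (R S : comalg F) (alpha : alghom R S) (f : autgrp P R) :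
  aut_inv (aut_map alpha f) = aut_map alpha (aut_inv f).
Proof.
have mulVf : aut_comp (aut_map alpha (aut_inv f)) (aut_map alpha f) = aut_id P S.
  transitivity (aut_map alpha (aut_comp (aut_inv f) f)).
    exact: esym (aut_mapM alpha (aut_inv f) f).
  apply: autgrp_eq; apply: ext_eqP => // [|i]; first exact: ext_end_lin.
  have [hl _ _] := autfunP (aut_comp (aut_inv f) f).
  by rewrite /= -(map_tens alpha) (ext_endE _ hl) /= (aut_inv_funK f).1.
by rewrite -[LHS]aut_comp1l -mulVf -aut_compA aut_compVr aut_comp1r.
Qed.

(** The entries of the inverse are coordinates too, so that invertibility becomes a polynomial
    identity in the coordinates. *)
Definition aut_coord (R : comalg F) (f : autgrp P R) (k : bool * 'I_n * 'I_n) : R :=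
  autmx (if k.1.1 then autfun f else aut_inv f) k.1.2 k.2.

(* The hypothesis is applied to the generic point, whose base changes along the
   points of the coordinate ring are the members of the group. *)
Lemma aut_functor_affine :
    (forall (A : comalg F) (D : forall R : comalg F, alghom A R -> Prop),
      separating D -> forall f g : ext V A -> ext V A, linear f -> linear g ->
      cancel f g -> cancel g f ->
      (forall R (chi : alghom A R), D R chi -> P R (ext_end chi f)) -> P A f) ->
  affine (aut_functor P).
Proof.
move=> Psep; pose c : forall R : comalg F, aut_functor P R -> _ -> R := aut_coord.
pose A := coordalg c.
(* The generic matrix ([true]) and its prospective inverse ([false]). *)
pose M b : 'M[A]_n := \matrix_(i, j) cr_var c (b, i, j).
have pointM (R : comalg F) (h : autgrp P R) b :
    map_mx (@cr_point _ _ _ c R h) (M b) = autmx (if b then autfun h else aut_inv h).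
  by apply/matrixP => i j; rewrite [in LHS]mxE [in LHS]mxE cr_point_var.
(* At every point these specialize to the matrices of an automorphism and of its inverse, and the
   points detect equality. *)
have M1 b : M b *m M (~~ b) = 1%:M.
  apply/matrixP => i j; apply: cr_eval_inj => R h.
  pose chi := @cr_point _ _ _ c R h.
  have : map_mx chi (M b *m M (~~ b)) = map_mx chi 1%:M.
    rewrite map_mxM !pointM map_mx1.
    by case: b; rewrite /= ?(autmx_aut_inv h).1 ?(autmx_aut_inv h).2.
  by move/matrixP/(_ i j); rewrite !(mxE (map_mx_key)).
pose f b (x : ext V A) : ext V A := x *m M b.
have fl b : linear (f b) := @mulmx_lin A (M b).
have fK b : cancel (f b) (f (~~ b)) by move=> x; rewrite /f -mulmxA M1 mulmx1.
have mxf b : autmx (f b) = M b.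
  by apply/matrixP => i j; rewrite mxE tens_bas /f -rowE mxE.
have PA : P A (f true).
  (* The evaluations at all group elements separate the coordinate ring by construction, and each of
     them sends the generic map to a member of the group. *)
  pose D (R : comalg F) (chi : alghom A R) := exists h, chi = @cr_point _ _ _ c R h.
  apply: (Psep A D _ (f true) (f false) (fl _) (fl _) (fK true) (fK false)).
    move=> a b ab; apply: cr_eval_inj => R h.
    exact: (ab R (cr_point c h) (ex_intro _ h erefl)).
  move=> R _ [h ->]; have [hl _ Ph] := autfunP (h : autgrp P R).
  rewrite (_ : ext_end _ _ = autfun (h : autgrp P R)) //; apply/funext => x.
  rewrite [RHS]autmxE // [LHS]autmxE; last exact: ext_end_lin.
  by rewrite autmx_ext_end // mxf pointM.
have fP : [/\ linear (f true), bijective (f true) & P A (f true)].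
  by split=> //; exists (f false); [exact: fK true | exact: fK false].
apply: (@affine_of_generic_point _ _ _ c (AutGrp fP : autgrp P A)).
- move=> R S alpha g [[b i] j]; have [gl _ _] := autfunP (g : autgrp P R).
  have [hl _ _] := autfunP (aut_inv (g : autgrp P R)).
  rewrite /c /aut_coord /=; case: b => /=.
    by rewrite autmx_ext_end // mxE.
  have -> : aut_inv_fun (aut_map alpha g) = aut_inv (aut_map alpha g) by [].
  by rewrite aut_inv_map autmx_ext_end // mxE.
- move=> R g h gh; have [gl _ _] := autfunP (g : autgrp P R).
  have [hl _ _] := autfunP (h : autgrp P R).
  apply: autgrp_eq => x; rewrite [LHS]autmxE // [RHS]autmxE //.
  by congr (_ *m _); apply/matrixP => i j; have := gh (true, i, j).
move=> [[b i] j]; rewrite /c /aut_coord /=; case: b.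
  by rewrite mxf mxE.
(* The chosen inverse of the generic map is multiplication by [M false], since inverses are
   unique. *)
set g := aut_inv_fun _.
have [fg gf] := aut_inv_funK (AutGrp fP).
have -> : autmx g = autmx (f false).
  by congr autmx; apply/funext => x; rewrite -[in RHS](gf x) (fK true).
by rewrite mxf mxE.
Qed.

End AutAffine.

(** Compatibility with the triple product is an equation of vectors whose two sides commute with
    base change, so it can be tested on a separating family. *)
Lemma AutW_affine (F : fieldType) (W : vectType F) (T : at2 W) : affine (AutW T).
Proof.
apply: aut_functor_affine => A D Dsep f g fl _ _ _ Df x y z.
apply: (separating_ext Dsep) => R chi /Df fchi.
by rewrite map_ext3 -!(ext_endE _ fl) -[RHS]fchi map_ext3.
Qed.

(** * The grading expressed by projections *)

Section Grading.
Variables (F : fieldType) (W : vectType F) (T : at2 W).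

Definition homproj (d : degree) (p : calA T) : calA T :=
  let: ((a, x), (y, b)) := p in
  match d with
  | deg_m1 => ((0, x), (0, 0))
  | deg_0 => ((a, 0), (0, b))
  | deg_1 => ((0, 0), (y, 0))
  end.

Lemma homproj_lin d : linear (homproj d).
Proof.
move=> k [[a x] [y b]] [[a' x'] [y' b']].
by case: d; congr ((_, _), (_, _)); rewrite /= ?scaler0 ?addr0.
Qed.

Lemma homogA_proj d p : homogA d p <-> homproj d p = p.
Proof.
case: p => [[a x] [y b]]; case: d => /=.
- by split=> [[-> -> ->] | [<- <- <-]].
- by split=> [[-> ->] | [<- <-]].
by split=> [[-> -> ->] | [<- <- <-]].
Qed.

Lemma homproj_homog d p : homogA d (homproj d p).
Proof. by case: p => [[a x] [y b]]; case: d. Qed.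

(** The projection fixes homogeneous vectors, and its values are combinations of projected basis
    vectors. This turns the existential definition of [AR_homog] into an equation, which can be
    tested after base change. *)
Lemma AR_homog_proj (R : comalg F) d (x : ext (calA T) R) :
  AR_homog d x <-> ext1 (homproj d) x = x.
Proof.
split=> [[m [c [u [ud ->]]]]|<-]; last first.
  exists _, (fun i => x 0 i), (fun i => homproj d (bas _ i)); split=> // i.
  exact: homproj_homog.
have hl : linear (ext1 (R := R) (homproj d)) := ext1_lin _.
elim: (index_enum _) => [|i r IHr]; first by rewrite !big_nil (linear_zero hl).
rewrite !big_cons hl IHr ext1_tens; last exact: homproj_lin.
by have /homogA_proj -> := ud i.
Qed.

Lemma AR_homog_map (R S : comalg F) (alpha : alghom R S) d (x : ext (calA T) R) :
  AR_homog d x -> AR_homog d (map_mx alpha x : ext (calA T) S).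
Proof.
move/AR_homog_proj => xd.
by apply/AR_homog_proj; rewrite -map_ext1 xd.
Qed.

Lemma AR_homog_sep (R : comalg F) (D : forall S : comalg F, alghom R S -> Prop) d
    (x : ext (calA T) R) : separating D ->
    (forall S (chi : alghom R S), D S chi ->
       AR_homog d (map_mx chi x : ext (calA T) S)) ->
  AR_homog d x.
Proof.
move=> Dsep xd; apply/AR_homog_proj; apply: (separating_ext Dsep) => S chi.
by move/xd/AR_homog_proj; rewrite map_ext1.
Qed.

End Grading.

Lemma AutA_affine (F : fieldType) (W : vectType F) (T : at2 W) : affine (AutA T).
Proof.
apply: aut_functor_affine => A D Dsep f g fl _ _ _ Df; split=> [|x y|x|d x].
- apply: (separating_ext Dsep) => R chi /Df[f1 _ _ _].
  by rewrite -ext_endE // map_tens.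
- apply: (separating_ext Dsep) => R chi /Df[_ fM _ _].
  by rewrite map_ext2 -!(ext_endE _ fl) -[RHS]fM map_ext2.
- apply: (separating_ext Dsep) => R chi /Df[_ _ fphi _].
  by rewrite map_ext1 -!(ext_endE _ fl) -[RHS]fphi map_ext1.
split=> [xd|fxd]; apply: (AR_homog_sep Dsep) => R chi /Df[_ _ _ fd].
  by rewrite -ext_endE //; apply: (fd _ _).1; apply: AR_homog_map.
by apply: (fd _ _).2; rewrite ext_endE //; apply: AR_homog_map.
Qed.

(** * Units of finite-dimensional semiprime algebras *)

Section SubspaceOfPredicate.
Variables (F : fieldType) (V : vectType F).

(** Among the finite families in [S], one whose span has maximal dimension already spans all of [S].
    The second clause is the induction principle of this span. *)
Lemma span_of_set (S : V -> Prop) : exists2 U : {vspace V},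
  (forall v, S v -> v \in U) &
  (forall P : V -> Prop, P 0 -> (forall a u v, P u -> P v -> P (a *: u + v)) ->
     (forall v, S v -> P v) -> {in U, forall v, P v}).
Proof.
pose Q (d : nat) := `[< exists2 X : seq V, {in X, forall v, S v} & \dim <<X>> = d >].
have Q0 : exists d, Q d.
  by exists 0%N; apply/asboolP; exists [::]; rewrite ?span_nil ?dimv0.
have Qmax d : Q d -> (d <= \dim {:V})%N.
  by move=> /asboolP[X _ <-]; rewrite dimvS // subvf.
case: (ex_maxnP Q0 Qmax) => d /asboolP[X XS dX] dmax.
exists <<X>>%VS => [v Sv|P P0 Plin PS]; last first.
  by apply: span_ind => // v /XS/PS.
have : (\dim <<v :: X>> <= \dim <<X>>)%N.
  rewrite dX; apply: dmax; apply/asboolP; exists (v :: X) => // u.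
  by rewrite inE => /orP[/eqP-> | /XS].
rewrite span_cons (geq_leqif (dimv_leqif_sup (addvSr _ _))) => /subvP; apply.
by apply: (subvP (addvSl _ _)); rewrite memv_line.
Qed.

Lemma subspace_of_pred (P : V -> Prop) :
    P 0 -> (forall a u v, P u -> P v -> P (a *: u + v)) ->
  exists U : {vspace V}, forall v, v \in U <-> P v.
Proof.
move=> P0 Plin; have [U US Uind] := span_of_set P.
by exists U => v; split=> [|/US//]; apply: (Uind P).
Qed.

End SubspaceOfPredicate.

Section SemiprimeUnit.
Variables (F : fieldType) (A : vectType F) (mul : A -> A -> A).
Hypotheses (mul_linl : forall b, linear (mul^~ b))
           (mul_linr : forall a, linear (mul a))
           (mulA : associative mul)
           (semiprime : forall a, (forall b, mul (mul a b) a = 0) -> a = 0).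
Local Infix "**" := mul (at level 40, left associativity).

Let mul0x b : 0 ** b = 0 := linear_zero (mul_linl b).
Let mulx0 a : a ** 0 = 0 := linear_zero (mul_linr a).
Let mulDx b x y : (x + y) ** b = x ** b + y ** b := linear_add (mul_linl b) x y.
Let mulxD a x y : a ** (x + y) = a ** x + a ** y := linear_add (mul_linr a) x y.
Let mulNx b x : (- x) ** b = - (x ** b).
Proof. by apply/eqP; rewrite -addr_eq0 -mulDx addNr mul0x. Qed.
Let mulxN a x : a ** (- x) = - (a ** x).
Proof. by apply/eqP; rewrite -addr_eq0 -mulxD addNr mulx0. Qed.

Let left_ideal (J : {vspace A}) := forall a x, x \in J -> a ** x \in J.

(** Induction on the dimension: either [J ** a] is a smaller nonzero left ideal, or it is [J], and
    then some [e] in [J] with [a = e ** a] is idempotent modulo the left ideal [J0] of the [v] in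
    [J] with [v ** a = 0]. *)
Lemma semiprime_idempotent (J : {vspace A}) :
  left_ideal J -> J != 0%VS -> exists e, [/\ e \in J, e != 0 & e ** e = e].
Proof.
have [n] := ubnP (\dim J); elim: n J => // n IHn J dJ JA Jn0.
(* If all products within [J] vanished, then [a ** (b ** a) = 0] for all [a] in [J] and all [b], and
   semiprimeness would give [J = 0]. *)
have [a aJ [x xJ xa0]] : exists2 a, a \in J & exists2 x, x \in J & x ** a != 0.
  apply: contrapT => noa; case/negP: Jn0; rewrite -subv0; apply/subvP => a aJ.
  rewrite memv0; apply/eqP/semiprime => b; rewrite -mulA; apply/eqP.
  by apply/negPn/negP => ba; apply: noa; exists (b ** a); [apply: JA | exists a].
have [Ja JaP] : exists U : {vspace A},
    forall v, v \in U <-> exists2 y, y \in J & v = y ** a.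
  apply: subspace_of_pred => [|k _ _ [y yJ ->] [z zJ ->]].
    by exists 0; rewrite ?mem0v.
  by exists (k *: y + z); rewrite ?mul_linl // memvD // memvZ.
have JaJ : (Ja <= J)%VS by apply/subvP => _ /JaP[y _ ->]; apply: JA.
have [J0 J0P] : exists U : {vspace A}, forall v, v \in U <-> v \in J /\ v ** a = 0.
  apply: subspace_of_pred => [|k u v [uJ ua] [vJ va]]; first by rewrite mem0v.
  by rewrite mul_linl ua va scaler0 addr0 memvD // memvZ.
have J0J : (J0 <= J)%VS by apply/subvP => v /J0P[].
have [dJa|] := ltnP (\dim Ja) (\dim J).
  have [|b _ /JaP[y yJ ->]||e [eJa e0 ee]] := IHn Ja.
  - exact: leq_trans dJa _.
  - apply/JaP; exists (b ** y); rewrite ?mulA //; exact: JA.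
  - apply: contraNneq xa0 => Ja0; rewrite -memv0 -Ja0; apply/JaP; by exists x.
  by exists e; rewrite (subvP JaJ _ eJa).
rewrite (geq_leqif (dimv_leqif_sup JaJ)) => /subvP/(_ a aJ)/JaP[e eJ ae].
have [J00|J0n0] := eqVneq J0 0%VS.
  exists e; split=> //; first by apply: contraNneq xa0 => e0; rewrite ae e0 mul0x mulx0.
  apply/eqP; rewrite -subr_eq0 -memv0 -J00; apply/J0P.
  by rewrite mulDx mulNx -mulA -!ae subrr memvB // JA.
(* The induction applies to [J0], which is smaller than [J] because [x] lies in [J] but not in
   [J0]. *)
have [|b y /J0P[yJ ya]|//|e' [/J0P[e'J _] e'0 e'e']] := IHn J0; last by exists e'.
  rewrite -ltnS; apply: leq_trans dJ; rewrite ltnS ltn_neqAle dimvS // andbT.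
  apply: contraNneq xa0 => dJ0.
  have /J0P[_ ->//] : x \in J0.
  by have /eqP := dJ0; rewrite (dimv_leqif_sup J0J) => /subvP; apply.
by apply/J0P; rewrite -mulA ya mulx0 JA.
Qed.

(** An idempotent [e] is a right unit as soon as [v ** e = 0] forces [v = 0], because [x - x ** e]
    is such a [v]. The space of these [v] is shrunk by enlarging [e]. *)
Lemma semiprime_unit : exists e, forall x, e ** x = x /\ x ** e = x.
Proof.
pose ann e (U : {vspace A}) := forall v, v \in U <-> v ** e = 0.
have annP e : exists U, ann e U.
  apply: subspace_of_pred => [|k u v ue ve]; first exact: mul0x.
  by rewrite mul_linl ue ve scaler0 addr0.
suff [e xe] : exists e, forall x, x ** e = x.
  (* A right unit is two-sided: [b ** (e ** x - x) = 0] for every [b], so semiprimeness kills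
     [e ** x - x]. *)
  exists e => x; split=> //; apply/eqP; rewrite -subr_eq0; apply/eqP.
  apply: semiprime => b; rewrite -mulA.
  by rewrite mulxD mulxN mulA xe subrr mulx0.
have [U0 U0P] := annP 0.
(* The enlargement starts from the idempotent [0], which the whole algebra annihilates. *)
have := mul0x 0; move: (0 : A) U0 U0P => e U.
have [n] := ubnP (\dim U); elim: n e U => // n IHn e U dU eU ee.
have [U_0|Un0] := eqVneq U 0%VS.
  exists e => x; apply/eqP; rewrite eq_sym -subr_eq0 -memv0 -U_0; apply/eU.
  by rewrite mulDx mulNx -mulA ee subrr.
have [b x /eU xe|f [/eU fe f0 ff]] := semiprime_idempotent _ Un0.
  by apply/eU; rewrite -mulA xe mulx0.
(* As [f ** e = 0], the element [e + f - e ** f] is again idempotent. Whatever annihilates it from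
   the left annihilates [e], whereas [f] annihilates only [e]. *)
have ee' : e ** (e + f - e ** f) = e by rewrite !mulxD mulxN mulA ee addrK.
have fe' : f ** (e + f - e ** f) = f.
  by rewrite !mulxD mulxN mulA fe mul0x ff add0r subr0.
have [U' e'U'] := annP (e + f - e ** f); apply: (IHn _ U' _ e'U').
  rewrite -ltnS; apply: leq_trans dU; rewrite ltnS ltn_neqAle.
  have U'U : (U' <= U)%VS.
    apply/subvP => x /e'U' xe'; apply/eU.
    have /(congr1 (mul^~ e)) := xe'.
    by rewrite -mulA !mulDx mulNx mul0x -mulA fe mulx0 ee oppr0 !addr0.
  rewrite dimvS // andbT; apply: contraNneq f0 => dU'.
  have /e'U' : f \in U'.
    have /eqP := dU'; rewrite (dimv_leqif_sup U'U) => /subvP; apply; exact/eU.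
  by rewrite fe' => ->.
by rewrite !mulDx mulNx -[e ** f ** _]mulA ee' fe'.
Qed.

End SemiprimeUnit.

(** * The unit in L_0 and R_0 *)

Section SimpleTriple.
Variables (F : fieldType) (W : vectType F) (T : at2 W).
Hypothesis simpleT : at2_simple T.

(** The span of all products is an ideal, nonzero because some product is, hence all of [W]. *)
Lemma triple_span_ind (P : W -> Prop) :
    P 0 -> (forall a u v, P u -> P v -> P (a *: u + v)) ->
    (forall x y z, P (T x y z)) ->
  forall w, P w.
Proof.
move=> P0 Plin PT w.
have [U US Uind] := span_of_set (fun v => exists x y z, v = T x y z).
have TU x y z : T x y z \in U by apply: US; exists x, y, z.
apply: Uind => // [_ [x [y [z ->]]]//|].
have [[x [y [z Txyz]]] /(_ U)[|U0|->]] := simpleT; last exact: memvf.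
  by move=> *; apply: TU.
by case/negP: Txyz; rewrite -memv0 -U0.
Qed.

Lemma L0_ind (P : 'End(W) * 'End(W) -> Prop) :
    P 0 -> (forall a u v, P u -> P v -> P (a *: u + v)) ->
    (forall x y, P (lambda T x y)) ->
  {in L0 T, forall u, P u}.
Proof.
move=> P0 Plin PL; apply: span_ind => // _ /allpairsP[[x y] [_ _ ->]].
exact: PL.
Qed.

Lemma L0_sub_L a : a \in L0 T -> a \in Lsp T.
Proof. exact: (subvP (addvSr _ _)). Qed.

Lemma mulL0_in a b : a \in L0 T -> b \in L0 T -> mulEop a b \in L0 T.
Proof.
move=> /L0_sub_L aL; move: b; apply: L0_ind => [|k u v uP vP|x y].
- by rewrite (linear_zero (mulEop_linr a)) mem0v.
- by rewrite mulEop_linr memvD // memvZ.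
by rewrite (actL_lambda aL x y).1 lambda_span.
Qed.

Section LAction.
Variable a : 'End(W) * 'End(W).
Hypothesis aL : a \in Lsp T.

(** This rule and the next three are the components of the two identities of [actL_lambda],
    evaluated at a vector. *)
Lemma act1_triple x y z : T (a.1 x) y z = a.1 (T x y z).
Proof.
have [/(congr1 (fun e : 'End(W) * 'End(W) => e.1 z)) + _] := actL_lambda aL x y.
by rewrite /= comp_lfunE !lopE.
Qed.

Lemma act2_triple x y z : T (a.2 x) y z = a.2 (T x y z).
Proof.
have [_ /(congr1 (fun e : 'End(W) * 'End(W) => e.2 z))] := actL_lambda aL y x.
by rewrite /= comp_lfunE !lopE.
Qed.

Lemma triple_act1 x y z : T x (a.1 y) z = T x y (a.2 z).
Proof.
have [/(congr1 (fun e : 'End(W) * 'End(W) => e.2 z)) + _] := actL_lambda aL y x.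
by rewrite /= comp_lfunE !lopE.
Qed.

Lemma triple_act2 x y z : T x (a.2 y) z = T x y (a.1 z).
Proof.
have [_ /(congr1 (fun e : 'End(W) * 'End(W) => e.1 z))] := actL_lambda aL x y.
by rewrite /= comp_lfunE !lopE.
Qed.

End LAction.

(* [a] and its conjugate together generate the ideal spanned by their images and
   by the [T x y v] with [v] in these images.  If it is zero then so is [a]; if
   it is [W], expanding the argument of [a] twice produces a factor [a b a]. *)
Lemma L0_semiprime a : a \in L0 T ->
    (forall b, b \in L0 T -> mulEop (mulEop a b) a = 0) ->
  a = 0.
Proof.
move=> /L0_sub_L aL aba; pose act (s : bool) : 'End(W) := if s then a.1 else a.2.
suff act0 : forall s w, act s w = 0.
  suff [a1 a2] : a.1 = 0 /\ a.2 = 0 by rewrite [a]surjective_pairing a1 a2.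
  by split; apply/lfunP => w; rewrite zero_lfunE;
    [apply: (act0 true) | apply: (act0 false)].
have actT s x y z : T (act s x) y z = act s (T x y z).
  by case: s; [apply: act1_triple | apply: act2_triple].
have Tact s x y z : T x (act s y) z = T x y (act (~~ s) z).
  by case: s; [apply: triple_act1 | apply: triple_act2].
(* The first component of [aba] for [lambda x y] is the case [true]; the second, for [lambda y x],
   is the case [false]. *)
have act_act s x y z : act s (T x y (act s z)) = 0.
  case: s.
    have /(congr1 (fun e : 'End(W) * 'End(W) => e.1 z)) := aba _ (lambda_span T x y).
    by rewrite /= !comp_lfunE lopE zero_lfunE.
  have /(congr1 (fun e : 'End(W) * 'End(W) => e.2 z)) := aba _ (lambda_span T y x).
  by rewrite /= !comp_lfunE lopE zero_lfunE.
have TT x y z u v : T x y (T z u v) = T (T x y z) u v.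
  by rewrite triple_as12 triple_as23.
pose S v := exists s z, v = act s z \/ exists x y, v = T x y (act s z).
have [I IS Iind] := span_of_set S.
have T1 y z := linear_zero (triple_lin1 T y z).
have T2 x z := linear_zero (triple_lin2 T x z).
have T3 x y := linear_zero (triple_lin3 T x y).
have actI s z : act s z \in I by apply: IS; exists s, z; left.
have TactI s x y z : T x y (act s z) \in I.
  by apply: IS; exists s, z; right; exists x, y.
have idealI : at2_ideal T I.
  suff IP v : v \in I -> forall p q, [/\ T v p q \in I, T p v q \in I & T p q v \in I].
    by move=> x y z /or3P[] /IP H; [case: (H y z) | case: (H x z) | case: (H x y)].
  move: v; apply: Iind => [p q|k u v uI vI p q|_ [s [z [->|[x [y ->]]]]] p q].
  - by rewrite T1 T2 T3 mem0v.
  - have [u1 u2 u3] := uI p q; have [v1 v2 v3] := vI p q.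
    by rewrite triple_lin1 triple_lin2 triple_lin3; split; rewrite memvD // memvZ.
  - by rewrite actT Tact.
  by rewrite -[T (T x y _) p q]TT actT -triple_as12 -[T (T p _ y) x q]TT Tact TT.
have [_ /(_ I idealI)[I0|IW]] := simpleT.
  by move=> s w; apply/eqP; rewrite -memv0 -I0.
(* Products span [W], and their third factor now lies in [I], so the vectors [T x y (act s z)]
   already span [W]. *)
have W_ind (P : W -> Prop) : P 0 -> (forall a u v, P u -> P v -> P (a *: u + v)) ->
    (forall s x y z, P (T x y (act s z))) -> forall w, P w.
  move=> P0 Plin PT; apply: triple_span_ind => // x y z.
  have : z \in I by rewrite IW memvf.
  move: z; apply: Iind => [|k u v uP vP|_ [s [z [->|[u [v ->]]]]]].
  - by rewrite T3.
  - by rewrite triple_lin3; apply: Plin.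
  - exact: PT.
  by rewrite TT.
(* For opposite flags [z] is expanded once more; the new factor [act s'] matches either the outer or
   the inner operator. *)
have act_act' s x y z : act s (T x y (act (~~ s) z)) = 0.
  move: z; apply: W_ind => [|k u v uP vP|s' u v z].
  - by rewrite linear0 T3 linear0.
  - by rewrite linearP triple_lin3 linearP /= uP vP scaler0 addr0.
  have [->|->] : s' = s \/ s' = ~~ s by case: (s); case: (s'); [left|right|right|left].
    by rewrite -[act (~~ s) _]actT TT act_act.
  by rewrite act_act T3 linear0.
move=> s; apply: W_ind => [|k u v u0 v0|s' x y z]; first exact: linear0.
  by rewrite linearP /= u0 v0 scaler0 addr0.
by have [->|->] : s' = s \/ s' = ~~ s by case: (s); case: (s'); [left|right|right|left].
Qed.

(** The semiprime algebra [L0] has a unit [e]. It fixes every [lambda x y], so both its components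
    act as the identity on products, which span [W]. *)
Lemma unitE_in_L0 : unitE W \in L0 T.
Proof.
pose A : vectType F := subvs_of (L0 T).
pose mul (a b : A) : A := Subvs (mulL0_in (subvsP a) (subvsP b)).
have [b k u v|a k u v|a b c|a aba|e eP] := @semiprime_unit F A mul.
- by apply: val_inj; rewrite /= mulEop_linl.
- by apply: val_inj; rewrite /= mulEop_linr.
- by apply: val_inj; rewrite /= mulEopA.
- apply: val_inj; apply: L0_semiprime (subvsP a) _ => b bL.
  by have /(congr1 val) := aba (Subvs bL).
have eL x y := eP (Subvs (lambda_span T x y)).
suff <- : vsval e = unitE W by apply: subvsP.
have e1T x y z : (vsval e).1 (T x y z) = T x y z.
  have /(congr1 val)/(congr1 (fun a : 'End(W) * 'End(W) => a.1 z)) := (eL x y).1.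
  by rewrite /= comp_lfunE lopE.
have e2T x y z : (vsval e).2 (T x y z) = T x y z.
  have /(congr1 val)/(congr1 (fun a : 'End(W) * 'End(W) => a.2 z)) := (eL y x).2.
  by rewrite /= comp_lfunE lopE.
rewrite [vsval e]surjective_pairing; congr (_, _); apply/lfunP => w;
  rewrite id_lfunE; move: w; apply: triple_span_ind => [|k u v uP vP|//];
  by rewrite ?linear0 // linearP /= uP vP.
Qed.

End SimpleTriple.

Section OppositeTriple.
Variables (F : fieldType) (W : vectType F) (T : at2 W).

Fact op_triple_as12 u v x y z :
  T z y (T x v u) = T z (T v x y) u.
Proof. by rewrite triple_as23. Qed.

Fact op_triple_as23 u v x y z :
  T z (T v x y) u = T (T z y x) v u.
Proof. by rewrite triple_as12. Qed.

(** Reversing the arguments exchanges left and right multiplications, which carries results on [L0]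
    over to [R0]. *)
Definition op_triple : at2 W :=
  @AT2 F W (fun x y z => T z y x)
    (fun y z => triple_lin3 T z y) (fun x z => triple_lin2 T z x)
    (fun x y => triple_lin1 T y x) op_triple_as12 op_triple_as23.

Lemma op_triple_simple : at2_simple T -> at2_simple op_triple.
Proof.
move=> [[x [y [z Txyz]]] sT]; split=> [|I idI]; first by exists z, y, x.
apply: sT => u v w uvw; apply: (idI w v u).
by move: uvw; rewrite orbC orbAC; case: (u \in I); case: (v \in I); case: (w \in I).
Qed.

Lemma unitE_in_R0 : at2_simple T -> unitE W \in R0 T.
Proof.
move=> /op_triple_simple/unitE_in_L0; apply/subvP/span_subvP => _ /allpairsP[[x y] [_ _ ->]].
suff -> : lambda op_triple x y = rho T y x by apply: rho_span.
by congr (_, _); apply/lfunP => z; rewrite lopE ropE.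
Qed.

End OppositeTriple.

(** * Entries and actions of elements of A(W) *)

Section Observations.
Variables (F : fieldType) (W : vectType F) (T : at2 W).

Definition off (t : bool) (p : calA T) : W := if t then p.1.2 else p.2.1.

Definition act (s t : bool) (p : calA T) (w : W) : W :=
  let e := if s then vsval p.1.1 else vsval p.2.2 in
  if t then e.1 w else e.2 w.

(** Second components multiply in the opposite order; reversing the factors for [false] gives one
    formula for both values of [t]. *)
Definition mulAS (t : bool) (p q : calA T) : calA T :=
  if t then mulA p q else mulA q p.

Lemma off_lin t : linear (off t).
Proof. by case: t. Qed.

Lemma act_linl s t w : linear (fun p => act s t p w).
Proof.
by case: s t => [] [] k p q; rewrite /act /= add_lfunE scale_lfunE.
Qed.

Lemma act_linr s t p : linear (act s t p).
Proof. by case: s t => [] [] k u v; rewrite /act linearP. Qed.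

Lemma mulAS_linl t q : linear (fun p => mulAS t p q).
Proof. by case: t; [apply: mulA_linl | apply: mulA_linr]. Qed.

Lemma mulAS_linr t p : linear (mulAS t p).
Proof. by case: t; [apply: mulA_linr | apply: mulA_linl]. Qed.

Lemma obs_eq0 (p : calA T) :
  (forall t, off t p = 0) -> (forall s t w, act s t p w = 0) -> p = 0.
Proof.
case: p => [[[a aL] x] [y [b bR]]] off0 act0.
have x0 : x = 0 := off0 true.
have y0 : y = 0 := off0 false.
have a0 : a = 0.
  rewrite [a]surjective_pairing; congr (_, _); apply/lfunP => w; rewrite zero_lfunE.
    exact: (act0 true true).
  exact: (act0 true false).
have b0 : b = 0.
  rewrite [b]surjective_pairing; congr (_, _); apply/lfunP => w; rewrite zero_lfunE.
    exact: (act0 false true).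
  exact: (act0 false false).
by rewrite x0 y0; congr ((_, _), (_, _)); apply: val_inj.
Qed.

Lemma off_mul t p q :
  off t (mulAS t p q) = act true t p (off t q) + act false t q (off t p).
Proof. by case: t p q => [] [[a x] [y b]] [[a' x'] [y' b']]. Qed.

Lemma act_mul_true t p q w :
  act true t (mulAS t p q) w =
    act true t p (act true t q w) + T (off t p) (off (~~ t) q) w.
Proof.
by case: t p q => [] [[a x] [y b]] [[a' x'] [y' b']];
  rewrite /act /= add_lfunE comp_lfunE lopE.
Qed.

Lemma act_mul_false t p q w :
  act false t (mulAS t p q) w =
    act false t q (act false t p w) + T w (off (~~ t) p) (off t q).
Proof.
by case: t p q => [] [[a x] [y b]] [[a' x'] [y' b']];
  rewrite /act /= add_lfunE comp_lfunE ropE addrC.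
Qed.

Lemma off_phi t p : off t (phiA p) = off (~~ t) p.
Proof. by case: t p => [] [[a x] [y b]]. Qed.

Lemma act_phi s t p w : act s t (phiA p) w = act s (~~ t) p w.
Proof. by case: s t p => [] [] [[a x] [y b]]. Qed.

Lemma off_one t : off t (oneA T) = 0.
Proof. by case: t. Qed.

Lemma act_one s t w : act s t (oneA T) w = w.
Proof. by case: s t => [] []; rewrite /act /= id_lfunE. Qed.

Lemma off_inW t w : off t (inW T w) = if t then w else 0.
Proof. by case: t. Qed.

Lemma act_inW s t w v : act s t (inW T w) v = 0.
Proof. by case: s t => [] []; rewrite /act /= zero_lfunE. Qed.

Definition off_in_degree (d : degree) (t : bool) : bool :=
  match d with deg_m1 => t | deg_0 => false | deg_1 => ~~ t end.

Lemma off_homproj d t p :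
  off t (homproj d p) = if off_in_degree d t then off t p else 0.
Proof. by case: d t p => [] [] [[a x] [y b]]. Qed.

Lemma act_homproj d s t p w :
  act s t (homproj d p) w = if d is deg_0 then act s t p w else 0.
Proof.
by case: d s t p => [] [] [] [[a x] [y b]]; rewrite /act //= zero_lfunE.
Qed.

(** By simplicity the units lie in [L0] and [R0], so the diagonal part is spanned by products of
    off-diagonal elements. *)
Lemma calA_ind (P : calA T -> Prop) : at2_simple T ->
    P 0 -> (forall a u v, P u -> P v -> P (a *: u + v)) ->
    (forall x, P (inW T x)) -> (forall x, P (phiA (inW T x))) ->
    (forall x y, P (mulA (inW T x) (phiA (inW T y)))) ->
    (forall x y, P (mulA (phiA (inW T x)) (inW T y))) ->
  forall p, P p.
Proof.
move=> simpleT P0 Plin Px Py Pxy Pyx [[a x] [y b]].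
have PD u v : P u -> P v -> P (u + v) by move=> Pu Pv; rewrite -[u]scale1r; apply: Plin.
have l0r c := linear_zero (lambda_linr T c).
have l0l c := linear_zero (lambda_linl T c).
have r0r c := linear_zero (rho_linr T c).
have r0l c := linear_zero (rho_linl T c).
have ELr c := linear_zero (@mulEop_linr _ W c).
have ERr c := linear_zero (@mulopE_linr _ W c).
have L_in (u : Lalg T) : vsval u \in L0 T.
  have: vsval u \in Lsp T := subvsP u.
  apply/subvP; rewrite subv_add subvv andbT -memvE; exact: unitE_in_L0.
have R_in (u : Ralg T) : vsval u \in R0 T.
  have: vsval u \in Rsp T := subvsP u.
  apply/subvP; rewrite subv_add subvv andbT -memvE; exact: unitE_in_R0.
have Pa : P ((a, 0), (0, 0)).
  (* The induction runs over vectors of [L0]; the witness [a'] carries the membership in [Lalg]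
     along. *)
  suff [a' /val_inj <-] : exists2 a' : Lalg T, vsval a' = vsval a & P ((a', 0), (0, 0)) by [].
  move: (vsval a) (L_in a); apply: L0_ind => [|k u v [u' <- Pu] [v' <- Pv]|x' y'].
  - by exists 0.
  - exists (k *: u' + v') => //.
    rewrite (_ : (_, _) = k *: ((u', 0), (0, 0)) + ((v', 0), (0, 0)) :> calA T); last first.
      by congr ((_, _), (_, _)); rewrite /= scaler0 addr0.
    exact: Plin.
  exists (lambdaL T x' y') => //; move: (Pxy x' y'); congr P.
  congr ((_, _), (_, _)); rewrite /= ?zero_lfunE ?addr0 //; apply: val_inj => /=.
    by rewrite ELr add0r.
  by rewrite ERr r0l addr0.
have Pb : P ((0, 0), (0, b)).
  suff [b' /val_inj <-] : exists2 b' : Ralg T, vsval b' = vsval b & P ((0, 0), (0, b')) by [].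
  move: (vsval b) (R_in b).
  apply: span_ind => [|k u v [u' <- Pu] [v' <- Pv]|_ /allpairsP[[x' y'] [_ _ ->]]].
  - by exists 0.
  - exists (k *: u' + v') => //.
    rewrite (_ : (_, _) = k *: ((0, 0), (0, u')) + ((0, 0), (0, v')) :> calA T); last first.
      by congr ((_, _), (_, _)); rewrite /= scaler0 addr0.
    exact: Plin.
  exists (rhoR T x' y') => //; move: (Pyx x' y'); congr P.
  congr ((_, _), (_, _)); rewrite /= ?zero_lfunE ?addr0 //; apply: val_inj => /=.
    by rewrite ELr l0l addr0.
  by rewrite ERr addr0.
rewrite (_ : (_, _) = ((a, 0), (0, 0)) + inW T x + phiA (inW T y) + ((0, 0), (0, b)) :> calA T).
  exact: (PD _ _ (PD _ _ (PD _ _ Pa (Px x)) (Py y)) Pb).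
have bL0 : barL 0 = 0 :> Lalg T by apply: val_inj.
have bR0 : barR 0 = 0 :> Ralg T by apply: val_inj.
by congr ((_, _), (_, _)); rewrite /= ?bL0 ?bR0 !addr0 ?add0r.
Qed.

End Observations.

(** Over a field the family splits: [v] is the sum of the [g k (f k v)] for linear [g k]. This
    identity extends to [R] and gives injectivity there. *)
Lemma ext1_jointly_inj (F : fieldType) (V V' : vectType F) (R : comalg F)
    (K : finType) (f : K -> V -> V') :
    (forall k, linear (f k)) -> (forall v, (forall k, f k v = 0) -> v = 0) ->
  forall x : ext V R, (forall k, ext1 (f k) x = 0) -> x = 0.
Proof.
move=> fl f_inj x fx.
pose h (v : V) : {ffun K -> V'} := [ffun k => f k v].
have hl : linear h by move=> a u v; apply/ffunP => k; rewrite !ffunE fl.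
pose hL := HB.pack_for {linear V -> {ffun K -> V'}} h (GRing.isLinear.Build F _ _ _ h hl).
have ker_h : lker (linfun hL) == 0%VS.
  rewrite -subv0; apply/subvP => v; rewrite memv_ker memv0 lfunE => /eqP hv0.
  by apply/eqP/f_inj => k; have /ffunP/(_ k) := hv0; rewrite !ffunE.
pose e k (u : V') : {ffun K -> V'} := [ffun j => if j == k then u else 0].
pose g k (u : V') : V := (linfun hL)^-1%VF (e k u).
have gl k : linear (g k).
  move=> a u v; rewrite /g -linearP; congr (_ _).
  by apply/ffunP => j; rewrite !ffunE; case: eqP; rewrite ?scaler0 ?addr0.
have gf v : \sum_k g k (f k v) = v.
  rewrite -linear_sum -[RHS](lker0_lfunK ker_h); congr (_ _); rewrite lfunE /=.
  apply/ffunP => j; rewrite sum_ffunE (bigD1 j) //= !ffunE eqxx big1 ?addr0 // => k /negbTE kj.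
  by rewrite ffunE eq_sym kj.
have -> : x = \sum_k ext1 (g k) (ext1 (f k) x).
  move: x {fx}; apply: ext_eqP => // [a x y|i].
    rewrite scaler_sumr -big_split; apply: eq_bigr => k _ /=.
    by rewrite (ext1_lin (f k)) (ext1_lin (g k)).
  under eq_bigr do rewrite !ext1_tens //.
  transitivity (tens R (\sum_k 1 *: g k (f k (bas V i)))).
    by congr (tens R _); rewrite -[LHS]gf; apply: eq_bigr => k _; rewrite scale1r.
  by rewrite tens_sum; apply: eq_bigr => k _; rewrite rmorph1 scale1r.
by rewrite big1 // => k _; rewrite fx (linear_zero (ext1_lin (g k))).
Qed.

Lemma ext2_swap (F : fieldType) (V1 V2 V' : vectType F) (R : comalg F)
    (f : V1 -> V2 -> V') (x : ext V1 R) (y : ext V2 R) :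
  ext2 f x y = ext2 (fun v u => f u v) y x.
Proof.
rewrite /ext2 /ext1; under eq_bigr do rewrite scaler_sumr.
rewrite exchange_big; apply: eq_bigr => j _; rewrite scaler_sumr.
by apply: eq_bigr => i _; rewrite !scalerA mulrC.
Qed.

Lemma lin2_eqP (F : fieldType) (V1 V2 : vectType F) (R : comalg F) (M : lmodType R)
    (f g : ext V1 R -> ext V2 R -> M) :
    (forall y, linear (f^~ y)) -> (forall y, linear (g^~ y)) ->
    (forall x, linear (f x)) -> (forall x, linear (g x)) ->
    (forall u v, f (tens R u) (tens R v) = g (tens R u) (tens R v)) ->
  forall x y, f x y = g x y.
Proof.
move=> fl gl fr gr fg x y; move: x; apply: ext_eqP => // i.
by move: y; apply: ext_eqP.
Qed.

Lemma lin3_eqP (F : fieldType) (V1 V2 V3 : vectType F) (R : comalg F) (M : lmodType R)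
    (f g : ext V1 R -> ext V2 R -> ext V3 R -> M) :
    (forall y z, linear (fun x => f x y z)) -> (forall y z, linear (fun x => g x y z)) ->
    (forall x z, linear (fun y => f x y z)) -> (forall x z, linear (fun y => g x y z)) ->
    (forall x y, linear (f x y)) -> (forall x y, linear (g x y)) ->
    (forall u v w, f (tens R u) (tens R v) (tens R w) = g (tens R u) (tens R v) (tens R w)) ->
  forall x y z, f x y z = g x y z.
Proof.
move=> f1 g1 f2 g2 f3 g3 fg x y z; move: x; apply: ext_eqP => // i.
by move: y z; apply: lin2_eqP.
Qed.

(** * Entries and actions after extension of scalars *)

Section ExtObservations.
Variables (F : fieldType) (W : vectType F) (T : at2 W) (R : comalg F).
Implicit Types (p q : ext (calA T) R) (u v w : ext W R) (s t : bool).

Definition AR_off t : ext (calA T) R -> ext W R := ext1 (off (T := T) t).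
Definition AR_act s t : ext (calA T) R -> ext W R -> ext W R :=
  ext2 (act (T := T) s t).
Definition AR_mulS t : ext (calA T) R -> ext (calA T) R -> ext (calA T) R :=
  ext2 (mulAS (T := T) t).
Definition WR_triple : ext W R -> ext W R -> ext W R -> ext W R := ext3 T.

Lemma AR_off_lin t : linear (AR_off t). Proof. exact: ext1_lin. Qed.
Lemma AR_act_linl s t w : linear (fun p => AR_act s t p w).
Proof. exact: ext2_linl. Qed.
Lemma AR_act_linr s t p : linear (AR_act s t p).
Proof. exact: ext2_linr. Qed.
Lemma AR_mulS_linl t q : linear (fun p => AR_mulS t p q).
Proof. exact: ext2_linl. Qed.
Lemma AR_mulS_linr t p : linear (AR_mulS t p).
Proof. exact: ext2_linr. Qed.
Lemma AR_phi_lin : linear (@AR_phi F W T R). Proof. exact: ext1_lin. Qed.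
Lemma AR_inW_lin : linear (@AR_inW F W T R). Proof. exact: ext1_lin. Qed.
Lemma WR_triple_lin1 v w : linear (fun u => WR_triple u v w).
Proof. exact: ext3_lin1. Qed.
Lemma WR_triple_lin2 u w : linear (fun v => WR_triple u v w).
Proof. exact: ext3_lin2. Qed.
Lemma WR_triple_lin3 u v : linear (WR_triple u v).
Proof. exact: ext3_lin3. Qed.

Lemma AR_off_tens t (p : calA T) : AR_off t (tens R p) = tens R (off t p).
Proof. by rewrite /AR_off ext1_tens //; apply: off_lin. Qed.
Lemma AR_act_tens s t (p : calA T) (w : W) :
  AR_act s t (tens R p) (tens R w) = tens R (act s t p w).
Proof. by rewrite /AR_act ext2_tens //; [apply: act_linl | apply: act_linr]. Qed.
Lemma AR_mulS_tens t (p q : calA T) :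
  AR_mulS t (tens R p) (tens R q) = tens R (mulAS t p q).
Proof. by rewrite /AR_mulS ext2_tens //; [apply: mulAS_linl | apply: mulAS_linr]. Qed.
Lemma AR_phi_tens (p : calA T) : AR_phi (tens R p) = tens R (phiA p).
Proof. by rewrite /AR_phi ext1_tens //; apply: phiA_lin. Qed.
Lemma AR_inW_tens (w : W) : AR_inW T (tens R w) = tens R (inW T w).
Proof. by rewrite /AR_inW ext1_tens //; apply: inW_lin. Qed.
Lemma WR_triple_tens (u v w : W) :
  WR_triple (tens R u) (tens R v) (tens R w) = tens R (T u v w).
Proof.
by rewrite /WR_triple ext3_tens //;
  [apply: triple_lin1 | apply: triple_lin2 | apply: triple_lin3].
Qed.

Let linE := (AR_off_lin, AR_act_linl, AR_act_linr, AR_mulS_linl, AR_mulS_linr,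
  AR_phi_lin, AR_inW_lin, WR_triple_lin1, WR_triple_lin2, WR_triple_lin3).
Let tensE := (AR_off_tens, AR_act_tens, AR_mulS_tens, AR_phi_tens, AR_inW_tens,
  WR_triple_tens).

Lemma tensD (V : vectType F) (u v : V) : tens R (u + v) = tens R u + tens R v.
Proof. by rewrite -[u]scale1r tens_lin rmorph1 !scale1r. Qed.

Lemma tens0 (V : vectType F) : tens R (0 : V) = 0.
Proof. by apply/rowP => j; rewrite !mxE linear0 rmorph0. Qed.

(** Discharges linearity side conditions, so that identities remain to be checked on pure tensors
    only. *)
Ltac lin := solve [repeat intro; rewrite /= ?linE ?scalerDr 1?addrACA //].

Lemma AR_mulS_false p q : AR_mulS false p q = AR_mul q p.
Proof. exact: ext2_swap. Qed.

Lemma AR_off_mul t p q : AR_off t (AR_mulS t p q) =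
  AR_act true t p (AR_off t q) + AR_act false t q (AR_off t p).
Proof.
move: p q; apply: lin2_eqP => [||||p q]; try lin.
by rewrite !tensE off_mul tensD.
Qed.

Lemma AR_act_mul_true t p q w : AR_act true t (AR_mulS t p q) w =
  AR_act true t p (AR_act true t q w) + WR_triple (AR_off t p) (AR_off (~~ t) q) w.
Proof.
move: p q w; apply: lin3_eqP => [||||||p q w]; try lin.
by rewrite !tensE act_mul_true tensD.
Qed.

Lemma AR_act_mul_false t p q w : AR_act false t (AR_mulS t p q) w =
  AR_act false t q (AR_act false t p w) + WR_triple w (AR_off (~~ t) p) (AR_off t q).
Proof.
move: p q w; apply: lin3_eqP => [||||||p q w]; try lin.
by rewrite !tensE act_mul_false tensD.
Qed.

Lemma AR_off_phi t p : AR_off t (AR_phi p) = AR_off (~~ t) p.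
Proof.
move: p; apply: ext_eqP => [||i]; try lin.
by rewrite !tensE off_phi.
Qed.

Lemma AR_act_phi s t p w : AR_act s t (AR_phi p) w = AR_act s (~~ t) p w.
Proof.
move: p w; apply: lin2_eqP => [||||p w]; try lin.
by rewrite !tensE act_phi.
Qed.

Lemma AR_off_one t : AR_off t (AR_one T R) = 0.
Proof. by rewrite /AR_one tensE off_one tens0. Qed.

Lemma AR_act_one s t w : AR_act s t (AR_one T R) w = w.
Proof.
move: w; apply: ext_eqP => [||i]; try lin.
by rewrite /AR_one !tensE act_one.
Qed.

Lemma AR_off_inW t w : AR_off t (AR_inW T w) = if t then w else 0.
Proof.
move: w; apply: ext_eqP => [||i]; try lin.
  by case: t => // a u v; rewrite scaler0 addr0.
by rewrite !tensE off_inW; case: t => //; rewrite tens0.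
Qed.

Lemma AR_act_inW s t w v : AR_act s t (AR_inW T w) v = 0.
Proof.
move: w v; apply: lin2_eqP => [||||w v]; try lin.
- by move=> v a u w; rewrite scaler0 addr0.
- by move=> v a u w; rewrite scaler0 addr0.
by rewrite !tensE act_inW tens0.
Qed.

Lemma AR_off_homproj d t p : AR_off t (ext1 (homproj (T := T) d) p) =
  if off_in_degree d t then AR_off t p else 0.
Proof.
have hl := ext1_lin (R := R) (homproj (T := T) d).
move: p; apply: ext_eqP => [a p q|a p q|i]; first by rewrite hl AR_off_lin.
  by case: off_in_degree; rewrite ?AR_off_lin // scaler0 addr0.
rewrite ext1_tens ?tensE ?off_homproj; last exact: homproj_lin.
by case: off_in_degree; rewrite ?tens0 ?tensE.
Qed.

Lemma AR_act_homproj d s t p w : AR_act s t (ext1 (homproj (T := T) d) p) w =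
  if d is deg_0 then AR_act s t p w else 0.
Proof.
have hl := ext1_lin (R := R) (homproj (T := T) d).
move: p w; apply: lin2_eqP => [w a p q|w a p q|p a u v|p a u v|p w].
- by rewrite hl AR_act_linl.
- by case: d {hl}; rewrite ?AR_act_linl // scaler0 addr0.
- by rewrite AR_act_linr.
- by case: d {hl}; rewrite ?AR_act_linr // scaler0 addr0.
rewrite ext1_tens ?tensE ?act_homproj; last exact: homproj_lin.
by case: d {hl}; rewrite ?tens0 ?tensE.
Qed.

Lemma AR_obs_eq0 p :
  (forall t, AR_off t p = 0) -> (forall s t w, AR_act s t p w = 0) -> p = 0.
Proof.
move=> off0 act0.
(* By linearity the actions are observed on basis vectors only, which keeps the family finite. *)
pose K : finType := (bool + (bool * bool * 'I_(\dim {:W})))%type.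
pose f (k : K) (a : calA T) : W :=
  match k with inl t => off t a | inr (s, t, i) => act s t a (bas W i) end.
apply: (ext1_jointly_inj (f := f)) => [k|a fa|[t|[[s t] i]]].
- by case: k => [t|[[s t] i]]; [apply: off_lin | apply: act_linl].
- apply: obs_eq0 => [t|s t w]; first exact: (fa (inl t)).
  have acta0 := linear_zero (act_linr s t a).
  rewrite (bas_sum w); elim: (index_enum _) => [|i r IHr]; first by rewrite big_nil acta0.
  by rewrite big_cons act_linr IHr addr0 [act _ _ _ _](fa (inr (s, t, i))) scaler0.
- exact: off0.
rewrite -(act0 s t (tens R (bas W i))) /AR_act /ext2 /ext1.
apply: eq_bigr => j _; congr (_ *: _); rewrite -/(ext1 _ _) ext1_tens //.
exact: act_linr.
Qed.

Lemma AR_obs_inj p q :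
  (forall t, AR_off t p = AR_off t q) ->
  (forall s t w, AR_act s t p w = AR_act s t q w) -> p = q.
Proof.
move=> offE actE; apply/eqP; rewrite -subr_eq0 addrC -scaleN1r; apply/eqP.
apply: AR_obs_eq0 => [t|s t w]; first by rewrite AR_off_lin offE scaleN1r addNr.
by rewrite AR_act_linl actE scaleN1r addNr.
Qed.

Lemma AR_ind (P : ext (calA T) R -> Prop) : at2_simple T ->
    P 0 -> (forall a p q, P p -> P q -> P (a *: p + q)) ->
    (forall w, P (AR_inW T w)) -> (forall w, P (AR_phi (AR_inW T w))) ->
    (forall v w, P (AR_mul (AR_inW T v) (AR_phi (AR_inW T w)))) ->
    (forall v w, P (AR_mul (AR_phi (AR_inW T v)) (AR_inW T w))) ->
  forall p, P p.
Proof.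
move=> simpleT P0 Plin Pw Pphi Pvw Pwv p; rewrite (ext_sum p).
suff Pt (a : calA T) : P (tens R a).
  elim: (index_enum _) => [|i r IHr]; first by rewrite big_nil.
  by rewrite big_cons; apply: Plin.
apply: (calA_ind (P := fun a => P (tens R a))) => // [|k u v Pu Pv|w|w|v w|v w].
- by rewrite tens0.
- by rewrite tens_lin; apply: Plin.
- by rewrite -AR_inW_tens.
- by rewrite -AR_phi_tens -AR_inW_tens.
- rewrite -[mulA _ _]/(mulAS true _ _) -AR_mulS_tens -AR_phi_tens -!AR_inW_tens.
  exact: Pvw.
rewrite -[mulA _ _]/(mulAS true _ _) -AR_mulS_tens -AR_phi_tens -!AR_inW_tens.
exact: Pwv.
Qed.

Lemma AR_tripleE u v w : AR_inW T (WR_triple u v w) =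
  AR_mul (AR_mul (AR_inW T u) (AR_phi (AR_inW T v))) (AR_inW T w).
Proof.
rewrite -![AR_mul _ _]/(AR_mulS true _ _).
move: u v w; apply: lin3_eqP => [||||||u v w]; try lin.
by rewrite !tensE tripleE.
Qed.

Lemma AR_prWK : cancel (@AR_inW F W T R) (@AR_prW F W T R).
Proof. by move=> w; rewrite -[RHS](AR_off_inW true w). Qed.

End ExtObservations.

(** * Extension and restriction of automorphisms *)

Section Intertwining.
Variables (F : fieldType) (W : vectType F) (T : at2 W) (R : comalg F).
Implicit Types (psi : ext W R -> ext W R) (p q : ext (calA T) R).

(* [q] is the image of [p] under conjugation by [psi]; as elements are
   determined by their off-diagonal entries and their actions, this relation is
   the graph of the extension of [psi]. *)
Definition intertwines psi p q : Prop :=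
  (forall t, AR_off t q = psi (AR_off t p)) /\
  (forall s t w, AR_act s t q (psi w) = psi (AR_act s t p w)).

Section Fixed.
Variables psi psiV : ext W R -> ext W R.
Hypotheses (psi_lin : linear psi) (psiVK : cancel psiV psi)
  (psi_triple : triple_aut T psi).
Let psi0 : psi 0 = 0 := linear_zero psi_lin.
Let psiD u v : psi (u + v) = psi u + psi v.
Proof. by have := psi_lin 1 u v; rewrite !scale1r. Qed.

Lemma intertwines_lin a p q p' q' :
    intertwines psi p q -> intertwines psi p' q' ->
  intertwines psi (a *: p + p') (a *: q + q').
Proof.
move=> [offq actq] [offq' actq']; split=> [t|s t w].
  by rewrite !AR_off_lin psi_lin offq offq'.
by rewrite !AR_act_linl psi_lin actq actq'.
Qed.

Lemma intertwines0 : intertwines psi 0 0.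
Proof.
split=> [t|s t w]; first by rewrite (linear_zero (AR_off_lin _)) psi0.
by rewrite !(linear_zero (AR_act_linl _ _ _)) psi0.
Qed.

(** As [psi] is onto, every vector on which an action is tested has the form [psi w]. *)
Lemma intertwines_inj p q q' :
  intertwines psi p q -> intertwines psi p q' -> q = q'.
Proof.
move=> [offq actq] [offq' actq']; apply: AR_obs_inj => [t|s t w].
  by rewrite offq offq'.
by rewrite -[w]psiVK actq actq'.
Qed.

Lemma intertwines_inW w : intertwines psi (AR_inW T w) (AR_inW T (psi w)).
Proof.
split=> [t|s t v]; last by rewrite !AR_act_inW psi0.
by rewrite !AR_off_inW; case: t; rewrite ?psi0.
Qed.

Lemma intertwines_phi p q :
  intertwines psi p q -> intertwines psi (AR_phi p) (AR_phi q).
Proof.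
by move=> [offq actq]; split=> [t|s t w]; rewrite ?AR_off_phi ?AR_act_phi.
Qed.

Lemma intertwines_one : intertwines psi (AR_one T R) (AR_one T R).
Proof.
by split=> [t|s t w]; rewrite ?AR_off_one ?psi0 // !AR_act_one.
Qed.

Lemma intertwines_homproj d p q : intertwines psi p q ->
  intertwines psi (ext1 (homproj (T := T) d) p) (ext1 (homproj (T := T) d) q).
Proof.
move=> [offq actq]; split=> [t|s t w].
  by rewrite !AR_off_homproj; case: off_in_degree; rewrite ?offq ?psi0.
by rewrite !AR_act_homproj; case: d; rewrite ?actq ?psi0.
Qed.

(** Entries and actions of a product are expressed by those of the factors and the triple product,
    which [psi] respects. *)
Lemma intertwines_mul p q p' q' :
    intertwines psi p q -> intertwines psi p' q' ->
  intertwines psi (AR_mul p p') (AR_mul q q').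
Proof.
have H t a b a' b' : intertwines psi a b -> intertwines psi a' b' ->
    AR_off t (AR_mulS t b b') = psi (AR_off t (AR_mulS t a a')) /\
    forall s w, AR_act s t (AR_mulS t b b') (psi w) = psi (AR_act s t (AR_mulS t a a') w).
  move=> [offb actb] [offb' actb']; split=> [|s w].
    by rewrite !AR_off_mul psiD offb offb' actb actb'.
  case: s; rewrite ?AR_act_mul_true ?AR_act_mul_false psiD !(actb, actb', offb, offb');
    by rewrite /WR_triple psi_triple.
move=> pq p'q'; split=> [t|s t w].
  case: t; first exact: (H true _ _ _ _ pq p'q').1.
  by rewrite -!AR_mulS_false; apply: (H false _ _ _ _ p'q' pq).1.
case: t; first exact: (H true _ _ _ _ pq p'q').2.
by rewrite -!AR_mulS_false; apply: (H false _ _ _ _ p'q' pq).2.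
Qed.

Lemma intertwines_total : at2_simple T ->
  forall p, exists q, intertwines psi p q.
Proof.
move=> simpleT; apply: AR_ind => // [|a p p' [q pq] [q' p'q']|w|w|v w|v w].
- by exists 0; apply: intertwines0.
- by exists (a *: q + q'); apply: intertwines_lin.
- by eexists; apply: intertwines_inW.
- by eexists; apply/intertwines_phi/intertwines_inW.
- by eexists; apply: intertwines_mul; [|apply: intertwines_phi]; apply: intertwines_inW.
by eexists; apply: intertwines_mul; [apply: intertwines_phi|]; apply: intertwines_inW.
Qed.

(** The projections respect the relation, so [q] and its projection are both related to [p] and
    coincide by uniqueness. *)
Lemma intertwines_homog d p q : intertwines psi p q -> AR_homog d p -> AR_homog d q.
Proof.
move=> pq /AR_homog_proj pd; apply/AR_homog_proj.
have := intertwines_homproj d pq; rewrite pd => pq'.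
exact: intertwines_inj pq' pq.
Qed.

Lemma intertwines_sym p q : cancel psi psiV ->
  intertwines psi p q -> intertwines psiV q p.
Proof.
move=> psiK [offq actq]; split=> [t|s t w]; first by rewrite offq psiK.
by apply: (can_inj psiK); rewrite -actq !psiVK.
Qed.

End Fixed.

Lemma intertwines_comp psi psi' p q r :
    intertwines psi p q -> intertwines psi' q r -> intertwines (psi' \o psi) p r.
Proof.
move=> [offq actq] [offr actr]; split=> [t|s t w] /=; first by rewrite offr offq.
by rewrite actr actq.
Qed.

End Intertwining.

(** By linearity the actions need only be compared on basis vectors, and these come from [R]. *)
Lemma map_intertwines (F : fieldType) (W : vectType F) (T : at2 W)
    (R S : comalg F) (alpha : alghom R S) (psi : ext W R -> ext W R)
    (p q : ext (calA T) R) : linear psi ->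
  intertwines psi p q ->
  intertwines (ext_end alpha psi) (map_mx alpha p : ext (calA T) S) (map_mx alpha q).
Proof.
move=> psi_lin [offq actq].
have off_map t (a : ext (calA T) R) :
    AR_off t (map_mx alpha a : ext (calA T) S) = map_mx alpha (AR_off t a).
  by rewrite /AR_off map_ext1.
split=> [t|s t w]; first by rewrite !off_map ext_endE // offq.
have act_map (a : ext (calA T) R) (v : ext W R) :
    AR_act s t (map_mx alpha a : ext (calA T) S) (map_mx alpha v) =
    map_mx alpha (AR_act s t a v).
  by rewrite /AR_act map_ext2.
have hl := ext_end_lin alpha psi.
move: w; apply: ext_eqP => [a u v|a u v|i].
- by rewrite hl AR_act_linr.
- by rewrite AR_act_linr hl.
by rewrite -(map_tens alpha) ext_endE // !act_map ext_endE // actq.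
Qed.

(** * Extension of automorphisms to A(W) *)

Section Theta.
Variables (F : fieldType) (W : vectType F) (T : at2 W).
Hypothesis simpleT : at2_simple T.

Section OneRing.
Variable R : comalg F.
Implicit Types psi : autgrp (triple_autfam T) R.

Let psi_lin psi : linear psi. Proof. by have [] := autfunP psi. Qed.
Let psi_triple psi : triple_aut T psi. Proof. by have [] := autfunP psi. Qed.
Let psiK psi : cancel psi (aut_inv psi). Proof. exact: (aut_inv_funK psi).1. Qed.
Let psiVK psi : cancel (aut_inv psi) psi. Proof. exact: (aut_inv_funK psi).2. Qed.

Definition theta_fun psi (p : ext (calA T) R) : ext (calA T) R :=
  sval (cid (intertwines_total (psi_lin psi) (psi_triple psi) simpleT p)).

Lemma theta_funP psi p : intertwines psi p (theta_fun psi p).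
Proof. exact: svalP (cid _). Qed.

(** Uniqueness makes the chosen value canonical; each property of [theta_fun] then follows by
    exhibiting a related element. *)
Lemma theta_fun_eq psi p q : intertwines psi p q -> theta_fun psi p = q.
Proof. exact: (intertwines_inj (psiVK psi) (theta_funP psi p)). Qed.

Lemma theta_fun_lin psi : linear (theta_fun psi).
Proof.
by move=> a p q; apply: theta_fun_eq; apply: (intertwines_lin (psi_lin psi));
  apply: theta_funP.
Qed.

Lemma theta_fun_subproof psi :
  [/\ linear (theta_fun psi), bijective (theta_fun psi) & calA_aut (theta_fun psi)].
Proof.
have cancel_theta psi1 psi2 : cancel psi1 psi2 -> cancel psi2 psi1 ->
    cancel (theta_fun psi1) (theta_fun psi2).
  move=> K12 K21 p; apply: theta_fun_eq.
  exact: intertwines_sym K21 _ _ K12 (theta_funP psi1 p).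
split; first exact: theta_fun_lin.
  by exists (theta_fun (aut_inv psi)); apply: cancel_theta;
    [apply: psiK | apply: psiVK | apply: psiVK | apply: psiK].
split=> [|p q|p|d p].
- exact/theta_fun_eq/intertwines_one.
- by apply/theta_fun_eq/intertwines_mul => //; apply: theta_funP.
- exact/theta_fun_eq/intertwines_phi/theta_funP.
have H := theta_funP psi p.
split; first exact: (intertwines_homog (psi_lin psi) (psiVK psi) H).
have HV := intertwines_sym (psiVK psi) (psiK psi) H.
exact: (intertwines_homog (psi_lin (aut_inv psi)) (psiK psi) HV).
Qed.

Definition theta_aut psi : autgrp (calA_autfam T) R :=
  @AutGrp _ _ (calA_autfam T) R _ (theta_fun_subproof psi).

End OneRing.

Fact theta_autM (R : comalg F) : {morph @theta_aut R : x y / (x * y)%g}.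
Proof.
move=> f g; apply: autgrp_eq => p; apply: theta_fun_eq.
exact: intertwines_comp (theta_funP g p) (theta_funP f (theta_fun g p)).
Qed.

Fact theta_aut_nat (R S : comalg F) (alpha : alghom R S)
    (f : autgrp (triple_autfam T) R) :
  theta_aut (aut_map alpha f) = aut_map alpha (theta_aut f).
Proof.
have [fl _ _] := autfunP f; apply: autgrp_eq.
apply: ext_eqP => [||i]; [exact: theta_fun_lin | exact: ext_end_lin |].
apply: theta_fun_eq; rewrite /= -(map_tens alpha) ext_endE; last exact: theta_fun_lin.
exact: map_intertwines fl (theta_funP f _).
Qed.

Definition theta : gf_morphism (AutW T) (AutA T) :=
  @GfMorphism F (AutW T) (AutA T) theta_aut theta_autM theta_aut_nat.

End Theta.

(** * Restriction of graded automorphisms to degree -1 *)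

Section Eta.
Variables (F : fieldType) (W : vectType F) (T : at2 W).

Lemma AR_homproj_phi (R : comalg F) (p : ext (calA T) R) :
  ext1 (homproj (T := T) deg_m1) (AR_phi p) =
    AR_phi (ext1 (homproj (T := T) deg_1) p).
Proof.
have hl d := ext1_lin (R := R) (homproj (T := T) d).
move: p; apply: ext_eqP => [a p q|a p q|i].
- by rewrite AR_phi_lin hl.
- by rewrite hl AR_phi_lin.
rewrite AR_phi_tens !ext1_tens ?AR_phi_tens; try exact: homproj_lin.
congr (tens R _); case: (bas _ i) => [[a x] [y b]].
by congr ((_, _), (_, _)); apply: val_inj.
Qed.

Lemma AR_phiK (R : comalg F) : involutive (@AR_phi F W T R).
Proof.
apply: ext_eqP => [a p q|//|i]; first by rewrite !AR_phi_lin.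
by rewrite !AR_phi_tens phiAK.
Qed.

Lemma AR_homog_inW (R : comalg F) (w : ext W R) : AR_homog deg_m1 (AR_inW T w).
Proof. by apply/AR_homog_m1P; exists w. Qed.

Lemma AR_homog_phi_inW (R : comalg F) (w : ext W R) :
  AR_homog deg_1 (AR_phi (AR_inW T w)).
Proof.
apply/AR_homog_proj; apply: (can_inj (@AR_phiK R)).
by rewrite -AR_homproj_phi AR_phiK; apply/AR_homog_proj/AR_homog_inW.
Qed.

Lemma AR_homog_1P (R : comalg F) (p : ext (calA T) R) :
  AR_homog deg_1 p -> exists w, p = AR_phi (AR_inW T w).
Proof.
move=> /AR_homog_proj pd.
have /AR_homog_m1P[w pw] : AR_homog deg_m1 (AR_phi p).
  by apply/AR_homog_proj; rewrite AR_homproj_phi pd.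
by exists w; rewrite -pw AR_phiK.
Qed.

Section OneRing.
Variable R : comalg F.
Implicit Types Psi : autgrp (calA_autfam T) R.

Definition eta_fun (Psi : ext (calA T) R -> ext (calA T) R) (w : ext W R) : ext W R :=
  AR_prW (Psi (AR_inW T w)).

(** [Psi] preserves degree $-1$, so applying [AR_prW] loses nothing. *)
Lemma inW_eta Psi w : AR_inW T (eta_fun Psi w) = Psi (AR_inW T w).
Proof.
have [_ _ [_ _ _ Psid]] := autfunP Psi.
have /AR_homog_m1P[v Psiw] := (Psid _ _).1 (AR_homog_inW w).
by rewrite /eta_fun Psiw AR_prWK.
Qed.

Lemma eta_fun_subproof Psi :
  [/\ linear (eta_fun Psi), bijective (eta_fun Psi) & triple_aut T (eta_fun Psi)].
Proof.
have inW_inj := can_inj (@AR_prWK F W T R).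
have [Psi_lin _ [_ PsiM Psiphi _]] := autfunP Psi.
have [K KV] := aut_inv_funK Psi.
split.
- move=> a u v; apply: inW_inj.
  by rewrite inW_eta !AR_inW_lin Psi_lin !inW_eta.
- exists (eta_fun (aut_inv Psi)) => w; apply: inW_inj; rewrite !inW_eta.
    exact: K.
  exact: KV.
(* Inside the algebra the triple product is $u\varphi(v)w$, which [Psi] preserves. *)
move=> u v w; apply: inW_inj.
by rewrite -/(WR_triple T _ _ _) inW_eta !AR_tripleE !(PsiM, Psiphi) !inW_eta.
Qed.

Definition eta_aut Psi : autgrp (triple_autfam T) R :=
  @AutGrp _ _ (triple_autfam T) R _ (eta_fun_subproof Psi).

End OneRing.

Fact eta_autM (R : comalg F) : {morph @eta_aut R : x y / (x * y)%g}.
Proof.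
move=> f g; apply: autgrp_eq => w; apply: (can_inj (@AR_prWK F W T R)).
apply: etrans (inW_eta (f * g)%g w) _.
exact: esym (etrans (inW_eta f _) (congr1 f (inW_eta g w))).
Qed.

Fact eta_aut_nat (R S : comalg F) (alpha : alghom R S)
    (f : autgrp (calA_autfam T) R) :
  eta_aut (aut_map alpha f) = aut_map alpha (eta_aut f).
Proof.
have [fl _ _] := autfunP f; have [gl _ _] := autfunP (eta_aut f).
have [hl _ _] := autfunP (eta_aut (aut_map alpha f)).
apply: autgrp_eq; apply: ext_eqP => [||i]; [exact: hl | exact: ext_end_lin |].
rewrite /= -(map_tens alpha) (ext_endE _ gl) /eta_fun.
by rewrite /AR_inW -map_ext1 (ext_endE _ fl) /AR_prW -map_ext1.
Qed.

Definition eta : gf_morphism (AutA T) (AutW T) :=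
  @GfMorphism F (AutA T) (AutW T) eta_aut eta_autM eta_aut_nat.

End Eta.

(** * Uniqueness of the extension and mutual inverses *)

Section Extension.
Variables (F : fieldType) (W : vectType F) (T : at2 W).
Hypothesis simpleT : at2_simple T.
Variable R : comalg F.

(** The defining conditions determine [Psi] on degrees $\pm1$ and on their mixed products, where the
    relation holds; these elements span. *)
Lemma is_calA_intertwines (psi : autgrp (triple_autfam T) R)
    (Psi : ext (calA T) R -> ext (calA T) R) p :
  is_calA psi Psi -> intertwines psi p (Psi p).
Proof.
have [psi_lin _ psi_triple] := autfunP psi.
move=> [Psi_lin Psi_m1 Psi_1 PsiM]; move: p.
have PsiW w : Psi (AR_inW T w) = AR_inW T (psi w).
  by rewrite (Psi_m1 _ (AR_homog_inW T w)) AR_prWK.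
have Psiphi w : Psi (AR_phi (AR_inW T w)) = AR_phi (AR_inW T (psi w)).
  by rewrite (Psi_1 _ (AR_homog_phi_inW T w)) AR_phiK AR_prWK.
have PsiMul1 a b : AR_homog deg_1 a /\ AR_homog deg_m1 b \/
    AR_homog deg_m1 a /\ AR_homog deg_1 b -> Psi (AR_mul a b) = AR_mul (Psi a) (Psi b).
  move=> ab; have := PsiM 1%N (fun=> a) (fun=> b); rewrite !big_ord1; apply.
  by case: ab => [[? ?]|[? ?]]; [left | right].
apply: AR_ind => // [|a p q pP qP|w|w|v w|v w].
- by rewrite (linear_zero Psi_lin); apply: intertwines0.
- by rewrite Psi_lin; apply: intertwines_lin.
- by rewrite PsiW; apply: intertwines_inW.
- by rewrite Psiphi; apply/intertwines_phi/intertwines_inW.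
- rewrite PsiMul1 ?PsiW ?Psiphi; first by apply: intertwines_mul => //;
    [|apply: intertwines_phi]; apply: intertwines_inW.
  by right; split; [apply: AR_homog_inW | apply: AR_homog_phi_inW].
rewrite PsiMul1 ?PsiW ?Psiphi; first by apply: intertwines_mul => //;
  [apply: intertwines_phi|]; apply: intertwines_inW.
by left; split; [apply: AR_homog_phi_inW | apply: AR_homog_inW].
Qed.

Lemma theta_inW (psi : autgrp (triple_autfam T) R) w :
  theta_fun simpleT psi (AR_inW T w) = AR_inW T (psi w).
Proof. by have [psi_lin _ _] := autfunP psi; apply/theta_fun_eq/intertwines_inW. Qed.

Lemma graded_aut_is_calA (Psi : autgrp (calA_autfam T) R) :
  is_calA (eta_fun Psi) Psi.
Proof.
have [Psi_lin _ [_ PsiM Psiphi _]] := autfunP Psi.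
split=> // [a /AR_homog_m1P[w ->]|a /AR_homog_1P[w ->]|n a b _].
- by rewrite AR_prWK inW_eta.
- by rewrite AR_phiK AR_prWK inW_eta Psiphi.
elim: (index_enum _) => [|i r IHr]; first by rewrite !big_nil (linear_zero Psi_lin).
by rewrite !big_cons -[X in Psi (X + _)]scale1r Psi_lin scale1r PsiM IHr.
Qed.

Lemma theta_autK (psi : autgrp (triple_autfam T) R) :
  eta_aut (theta_aut simpleT psi) = psi.
Proof. by apply: autgrp_eq => w; rewrite /= /eta_fun /= theta_inW AR_prWK. Qed.

(** A graded automorphism is an extension of its own restriction, and such an extension is
    unique. *)
Lemma eta_autK (Psi : autgrp (calA_autfam T) R) :
  theta_aut simpleT (eta_aut Psi) = Psi.
Proof.
apply: autgrp_eq => p; apply: theta_fun_eq; apply: is_calA_intertwines.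
exact: graded_aut_is_calA.
Qed.

Lemma is_calA_theta (psi : autgrp (triple_autfam T) R)
    (Psi : ext (calA T) R -> ext (calA T) R) :
  is_calA psi Psi <-> Psi =1 theta_aut simpleT psi.
Proof.
split=> [PsiP p|/funext ->].
  by apply/esym/theta_fun_eq/is_calA_intertwines.
(* Writing [psi] as the restriction of its extension reduces the claim to graded automorphisms. *)
by rewrite -{1}[psi]theta_autK; apply: graded_aut_is_calA.
Qed.

End Extension.

Local Close Scope ring_scope.

Theorem theorem3p20 (F : fieldType) (charF : 2 \notin [pchar F]%R)
    (W : vectType F) (T : at2 W) (simpleT : at2_simple T) :
  [/\ affine (AutW T),
      affine (AutA T)
    & exists (theta : gf_morphism (AutW T) (AutA T))
             (eta : gf_morphism (AutA T) (AutW T)),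
      [/\ forall (R : comalg F) (psi : AutW T R)
            (Psi : ext (calA T) R -> ext (calA T) R),
            is_calA (AutW_fun psi) Psi <-> Psi =1 AutA_fun (theta R psi),
          forall R : comalg F, cancel (theta R) (eta R),
          forall R : comalg F, cancel (eta R) (theta R)
        & forall (R : comalg F) (Psi : AutA T R) (w : ext W R),
            AutA_fun Psi (AR_inW T w) = AR_inW T (AutW_fun (eta R Psi) w)]].
Proof.
split; [exact: AutW_affine | exact: AutA_affine |].
exists (theta simpleT), (eta T); split.
- by move=> R psi Psi; apply: is_calA_theta.
- by move=> R psi; apply: theta_autK.
- by move=> R Psi; apply: eta_autK.
by move=> R Psi w; apply/esym/inW_eta.
Qed.
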